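(* Let $X$ be a complex Banach space and let $T\colon X\to X$ be an $R$-Ritt operator which satisfies the unconditional Ritt condition. Then there exists $\gamma\in\bigl(0,\frac{\pi}{2}\bigr)$ such that $T$ admits a bounded $\mathcal{H}^\infty(B_\gamma)$ functional calculus.
   Context: Let $\mathbb{D}=\{z\in\mathbb{C}:|z|<1\}$. Let $X$ be a complex Banach space and $T\colon X\to X$ a bounded linear operator, with resolvent $R(\lambda,T)=(\lambda-T)^{-1}$. A set $\mathcal{F}$ of bounded operators on $X$ is $R$-bounded if there is a constant $C\geq 0$ such that for every finite family $S_1,\dots,S_n\in\mathcal{F}$ and $x_1,\dots,x_n\in X$, $\mathbb{E}\bigl\|\sum_{j}\varepsilon_j S_jx_j\bigr\|\leq C\,\mathbb{E}\bigl\|\sum_j\varepsilon_jx_j\bigr\|$, where $(\varepsilon_j)$ are independent random variables uniformly distributed on $\{-1,1\}$. $T$ is a Ritt operator if its spectrum is included in $\overline{\mathbb{D}}$ and the set $\{(\lambda-1)R(\lambda,T):|\lambda|>1\}$ is bounded; it is $R$-Ritt if moreover this set is $R$-bounded. $T$ satisfies the unconditional Ritt condition if there is a constant $K\geq 0$ such that $\bigl\|\sum_{k\geq 1}a_k(T^k-T^{k-1})\bigr\|\leq K\sup\{|a_k|:k\geq 1\}$ for every finite sequence $(a_k)_{k\geq 1}$ of complex numbers. For $\gamma\in\bigl(0,\frac{\pi}{2}\bigr)$, the Stolz domain $B_\gamma$ is the interior of the convex hull of the point $1$ and the disc $D(0,\sin\gamma)$. A Ritt operator $T$ has a bounded $\mathcal{H}^\infty(B_\gamma)$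 functional calculus if there is a constant $K\geq 0$ such that $\|P(T)\|\leq K\sup\{|P(z)|:z\in B_\gamma\}$ for every complex polynomial $P$. *)

(* Defs.v *)
From HB Require Import structures.
From mathcomp Require Import all_boot all_order all_algebra.
From mathcomp Require Import complex.
From mathcomp Require Import all_classical all_reals all_analysis.

Set Implicit Arguments.
Unset Strict Implicit.
Unset Printing Implicit Defensive.

Import Order.TTheory GRing.Theory Num.Theory.
Import numFieldNormedType.Exports.

Local Open Scope classical_set_scope.
Local Open Scope ring_scope.
Local Open Scope complex_scope.

(** A complex Banach space is a [completeNormedModType R[i]] with
    [R : realType].  Its norm [`|x|] is an element of [R[i]], always a
    nonnegative real, and is read back in [R] by [rnorm]. *)

Definition rnorm (R : realType) (V : normedZmodType R[i]) (x : V) : R :=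
  complex.Re `|x|.

Lemma rnormE (R : realType) (V : normedZmodType R[i]) (x : V) :
  (rnorm x)%:C = `|x|.
Proof. exact: RRe_real (normr_real x). Qed.

Section Operators.
Variables (R : realType) (X : completeNormedModType R[i]).
Implicit Types (T S : X -> X) (l : R[i]).

(** The supremum is taken in the extended reals, so that unbounded maps have
    norm [+oo]. *)
Definition opnorm S : \bar R :=
  ereal_sup [set (rnorm (S x))%:E | x in [set x : X | rnorm x <= 1]].

Definition bounded_operator S : Prop := linear S /\ (opnorm S < +oo)%E.

Definition is_resolvent T l S : Prop :=
  [/\ bounded_operator S,
      cancel (fun x => l *: x - T x) S & cancel S (fun x => l *: x - T x)].

Definition spectrum T : set R[i] :=
  [set l | ~ exists S, is_resolvent T l S].

(** [R(l, T)]; the default value [0] is only used when [l] is in the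
    spectrum of [T]. *)
Definition resolvent T l : X -> X := xget (fun=> 0) (is_resolvent T l).

Definition Ritt_set T : set (X -> X) :=
  [set (fun x => (l - 1) *: resolvent T l x) | l in [set l | 1 < rnorm l]].

(** [E || sum_j eps_j x_j ||] for independent uniform signs [eps_j]: the
    vector of signs is uniform on [{-1, 1}^n], so the expectation is the mean
    over the [2 ^ n] choices of signs, [e j : bool] coding [(-1) ^+ e j]. *)
Definition Rademacher_mean (n : nat) (x : 'I_n -> X) : R :=
  (\sum_(e : {ffun 'I_n -> bool})
     rnorm (\sum_(j < n) (-1) ^+ e j *: x j)) / 2 ^+ n.

Definition R_bounded (F : set (X -> X)) : Prop :=
  exists C : R, 0 <= C /\
    forall (n : nat) (S : 'I_n -> X -> X) (x : 'I_n -> X),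
      (forall j, F (S j)) ->
      Rademacher_mean (fun j => S j (x j)) <= C * Rademacher_mean x.

Definition Ritt T : Prop :=
  spectrum T `<=` [set l | rnorm l <= 1] /\
  exists C : R, forall S, Ritt_set T S -> (opnorm S <= C%:E)%E.

Definition R_Ritt T : Prop := Ritt T /\ R_bounded (Ritt_set T).

(** The coefficient of [T^k - T^(k-1)], [k >= 1], is [a (k - 1)]. *)
Definition unconditional_Ritt T : Prop :=
  exists K : R, 0 <= K /\
    forall (n : nat) (a : 'I_n -> R[i]),
      (opnorm (fun x : X =>
         (\sum_(k < n) a k *: (iter k.+1 T x - iter k T x))%R)
       <= (K * \big[Num.max/0]_(k < n) rnorm (a k))%:E)%E.

Definition poly_op (P : {poly R[i]}) T : X -> X :=
  fun x => \sum_(k < size P) P`_k *: iter k T x.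

End Operators.

(** The coefficients of the convex combinations in [convex_set] are elements
    [t] of [R[i]] with [0 <= t <= 1], hence real: this is the convexity of the
    real plane. *)
Definition convex_hull (R : realType) (A : set R[i]^o) : set R[i]^o :=
  smallest (@convex_set R[i] R[i]^o) A.

Definition Stolz_domain (R : realType) (gamma : R) : set R[i]^o :=
  (convex_hull ([set 1] `|` ball (0 : R[i]^o) (sin gamma)%:C))°.

Definition bounded_Hinfty_calculus (R : realType)
    (X : completeNormedModType R[i]) (gamma : R) (T : X -> X) : Prop :=
  exists K : R, 0 <= K /\
    forall P : {poly R[i]},
      (opnorm (poly_op P T) <=
       K%:E * ereal_sup [set (rnorm P.[z])%:E | z in Stolz_domain gamma])%E.

(* Main.v *)
(** R-Rittness extends, by a Neumann series, from the outside of the unit disc to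
    a region whose boundary is a curve [Gamma] with a corner at [1] that stays
    close to the unit circle; [gamma] is then chosen so close to [pi / 2] that
    [Gamma] lies in the Stolz domain, apart from the point [1].  Write
    [Q(T) = 1 / (2 i pi) int_Gamma Q(l) R(l, T) dl] for a polynomial [Q]
    vanishing at [1].  If [|Q(l)| <= M n |l - 1| |l| ^ n] on [Gamma], the measure
    [|Q(l)| |dl| / |l - 1|] has mass [O(M)] uniformly in [n], so all these [Q(T)]
    lie in an absolutely convex hull of an R-bounded set.  The integral is used
    only through Riemann sums, with [r T] for [T], where [r < 1] tends to [1].

    For the dyadic blocks [A_j = T ^ (2 ^ (j + 1)) - T ^ (2 ^ j)] the
    unconditional Ritt condition bounds every signed sum [sum_j +-A_j].  A
    telescoping identity writes [P(T)] as [sum_j A_j F_j A_j] plus two harmless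
    terms, with [F_j = P(T) g(T ^ (2 ^ j))] R-bounded by the first part.
    Randomizing the signs, [sum_j A_j F_j A_j x] is the mean of
    [(sum_j e_j A_j) (sum_i e_i F_i A_i x)], whose norm is at most
    [K . C sup |P| . K |x|]; no duality is needed. *)

Require Import Defs.
From HB Require Import structures.
From mathcomp Require Import all_boot all_order all_algebra.
From mathcomp Require Import complex.
From mathcomp Require Import all_classical all_reals all_analysis.
From mathcomp Require Import ring lra.

Set Implicit Arguments.
Unset Strict Implicit.
Unset Printing Implicit Defensive.

Import Order.TTheory GRing.Theory Num.Theory.
Import numFieldNormedType.Exports.

Local Open Scope classical_set_scope.
Local Open Scope ring_scope.
Local Open Scope complex_scope.

(** * Norms and Rademacher means *)

Section RealNorm.
Variables (R : realType) (V : normedZmodType R[i]).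
Implicit Types (x y : V).

Lemma rnorm_ge0 x : 0 <= rnorm x.
Proof. by rewrite -ler0c rnormE normr_ge0. Qed.

Lemma rnorm0 : rnorm (0 : V) = 0.
Proof. by rewrite /rnorm normr0. Qed.

Lemma rnormN x : rnorm (- x) = rnorm x.
Proof. by rewrite /rnorm normrN. Qed.

Lemma rnormBC x y : rnorm (x - y) = rnorm (y - x).
Proof. by rewrite /rnorm distrC. Qed.

Lemma ler_rnormD x y : rnorm (x + y) <= rnorm x + rnorm y.
Proof. by rewrite -lecR rmorphD /= !rnormE ler_normD. Qed.

Lemma ler_rnormB x y : rnorm (x - y) <= rnorm x + rnorm y.
Proof. by rewrite -(rnormN y) ler_rnormD. Qed.

Lemma ler_rnorm_dist x y : rnorm x <= rnorm y + rnorm (x - y).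
Proof. by rewrite -[x in X in X <= _](subrK y) addrC ler_rnormD. Qed.

Lemma rnorm_eq0 x : (rnorm x == 0) = (x == 0).
Proof. by rewrite -(inj_eq (@complexI R)) rnormE normr_eq0. Qed.

Lemma rnorm_gt0 x : (0 < rnorm x) = (x != 0).
Proof. by rewrite lt_def rnorm_eq0 rnorm_ge0 andbT. Qed.

Lemma ler_rnorm_sum (I : Type) (r : seq I) (P : pred I) (F : I -> V) :
  rnorm (\sum_(i <- r | P i) F i) <= \sum_(i <- r | P i) rnorm (F i).
Proof.
elim/big_rec2: _ => [|i y z _ h]; first by rewrite rnorm0.
by apply: le_trans (ler_rnormD _ _) _; rewrite lerD2l.
Qed.

End RealNorm.

Section ScalarNorm.
Variable R : realType.
Implicit Types (a b : R[i]) (r : R).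

Lemma rnormM a b : rnorm (a * b) = rnorm a * rnorm b.
Proof. by apply: complexI; rewrite rmorphM /= !rnormE normrM. Qed.

Lemma rnorm1 : rnorm (1 : R[i]) = 1.
Proof. by apply: complexI; rewrite rnormE normr1. Qed.

Lemma rnormX a n : rnorm (a ^+ n) = rnorm a ^+ n.
Proof. by elim: n => [|n IH]; rewrite ?rnorm1 // !exprS rnormM IH. Qed.

Lemma rnormV a : rnorm a^-1 = (rnorm a)^-1.
Proof.
apply: complexI; rewrite rnormE normfV -rnormE.
by rewrite (fmorphV (@real_complex R)).
Qed.

Lemma rnorm_real r : rnorm r%:C = `|r|.
Proof.
apply: complexI; rewrite rnormE normc_def /=.
by rewrite (expr0n _ 2) addr0 sqrtr_sqr.
Qed.

Lemma rnorm_nat n : rnorm (n%:R : R[i]) = n%:R.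
Proof. by rewrite -(rmorph_nat (@real_complex R)) rnorm_real normr_nat. Qed.

Lemma rnorm_sqr a : rnorm a ^+ 2 = complex.Re a ^+ 2 + complex.Im a ^+ 2.
Proof. by apply: complexI; rewrite add_Re2_Im2 rmorphXn /= rnormE. Qed.

Lemma ler_Re_rnorm a : `|complex.Re a| <= rnorm a.
Proof. by rewrite -lecR rnormE normc_ge_Re. Qed.

Lemma ler_Im_rnorm a : `|complex.Im a| <= rnorm a.
Proof.
rewrite -(ler_pXn2r (n := 2)) ?nnegrE ?rnorm_ge0 //.
by rewrite real_normK ?num_real // rnorm_sqr lerDr sqr_ge0.
Qed.

Lemma rnormi : rnorm ('i%C : R[i]) = 1.
Proof.
apply/eqP; rewrite -(eqrXn2 (n := 2)) ?rnorm_ge0 //.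
by rewrite rnorm_sqr /= expr0n expr1n add0r.
Qed.

Lemma rnorm_sign (b : bool) : rnorm ((-1) ^+ b : R[i]) = 1.
Proof. by rewrite rnormX rnormN rnorm1 expr1n. Qed.

Lemma rnormZ (V : normedModType R[i]) a (x : V) :
  rnorm (a *: x) = rnorm a * rnorm x.
Proof. by apply: complexI; rewrite rmorphM /= !rnormE normrZ. Qed.

End ScalarNorm.

(** * Rademacher means: sign changes, convex hulls and the contraction principle *)

Section Rademacher.
Variables (R : realType) (X : completeNormedModType R[i]).

Local Notation rad := (@Rademacher_mean R X _).

Lemma pow2_gt0 n : 0 < 2 ^+ n :> R.
Proof. by rewrite exprn_gt0. Qed.

Lemma Rademacher_ge0 n (x : 'I_n -> X) : 0 <= rad x.
Proof.
apply: divr_ge0; last exact/ltW/pow2_gt0.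
by apply: sumr_ge0 => e _; apply: rnorm_ge0.
Qed.

Lemma eq_Rademacher n (x y : 'I_n -> X) : x =1 y -> rad x = rad y.
Proof. by move=> exy; congr rad; apply/funext. Qed.

Lemma ler_Rademacher_mean n (x : 'I_n -> X) (c : R) :
  (forall e : {ffun 'I_n -> bool}, c <= rnorm (\sum_j (-1) ^+ e j *: x j)) ->
  c <= rad x.
Proof.
move=> h; rewrite ler_pdivlMr ?pow2_gt0 //.
have -> : c * 2 ^+ n = \sum_(e : {ffun 'I_n -> bool}) c.
  by rewrite sumr_const card_ffun card_bool card_ord -[RHS]mulr_natr natrX.
by apply: ler_sum => e _; apply: h.
Qed.

Lemma Rademacher_mean_le n (x : 'I_n -> X) (c : R) :
  (forall e : {ffun 'I_n -> bool}, rnorm (\sum_j (-1) ^+ e j *: x j) <= c) ->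
  rad x <= c.
Proof.
move=> h; rewrite ler_pdivrMr ?pow2_gt0 //.
have -> : c * 2 ^+ n = \sum_(e : {ffun 'I_n -> bool}) c.
  by rewrite sumr_const card_ffun card_bool card_ord -[RHS]mulr_natr natrX.
by apply: ler_sum => e _; apply: h.
Qed.

Lemma RademacherD n (x y : 'I_n -> X) :
  rad (fun j => x j + y j) <= rad x + rad y.
Proof.
rewrite -mulrDl -big_split; apply: ler_wpM2r.
  by rewrite invr_ge0 ltW ?pow2_gt0.
apply: ler_sum => e _ /=.
under eq_bigr do rewrite scalerDr.
by rewrite big_split /= ler_rnormD.
Qed.

Lemma Rademacher_sum n (I : Type) (r : seq I) (x : I -> 'I_n -> X) :
  rad (fun j => \sum_(i <- r) x i j) <= \sum_(i <- r) rad (x i).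
Proof.
elim: r => [|i r IH].
  rewrite big_nil; apply: Rademacher_mean_le => e.
  by rewrite big1 ?rnorm0 // => j _; rewrite big_nil scaler0.
rewrite big_cons (@eq_Rademacher _ _ (fun j => x i j + \sum_(i <- r) x i j)).
  by apply: le_trans (RademacherD _ _) _; rewrite lerD2l.
by move=> j; rewrite big_cons.
Qed.

Lemma RademacherZ n a (x : 'I_n -> X) :
  rad (fun j => a *: x j) = rnorm a * rad x.
Proof.
rewrite /Rademacher_mean mulrA mulr_sumr; congr (_ / _).
apply: eq_bigr => e _; rewrite -rnormZ scaler_sumr; congr rnorm.
by apply: eq_bigr => j _; rewrite !scalerA mulrC.
Qed.

Lemma Rademacher_le_sum n (x : 'I_n -> X) : rad x <= \sum_j rnorm (x j).
Proof.
apply: Rademacher_mean_le => e; apply: le_trans (ler_rnorm_sum _ _ _) _.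
by apply: ler_sum => j _; rewrite rnormZ rnorm_sign mul1r.
Qed.

(** Adding a fixed pattern [s] modulo 2 permutes the sign vectors. *)
Lemma Rademacher_sign n (s : 'I_n -> bool) (x : 'I_n -> X) :
  rad (fun j => (-1) ^+ s j *: x j) = rad x.
Proof.
rewrite /Rademacher_mean; congr (_ / _).
pose h (e : {ffun 'I_n -> bool}) := [ffun j => e j (+) s j].
have hK : involutive h.
  by move=> e; apply/ffunP => j; rewrite !ffunE -addbA addbb addbF.
rewrite [RHS](reindex h) /=; last by exists h => e _; apply: hK.
apply: eq_bigr => e _; congr rnorm; apply: eq_bigr => j _.
by rewrite ffunE scalerA signr_addb.
Qed.

Lemma Rademacher1 (x : X) : rad (fun _ : 'I_1 => x) = rnorm x.
Proof.
apply/eqP; rewrite eq_le Rademacher_mean_le ?ler_Rademacher_mean // => e;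
  by rewrite big_ord_recl big_ord0 addr0 rnormZ rnorm_sign mul1r.
Qed.

(* A convex function of several variables is maximal at extreme points:
   coordinates are moved into the convex hull one at a time. *)
Lemma Rademacher_convex n (I : finType) (w : 'I_n -> I -> R)
    (v : 'I_n -> I -> X) (D : R) :
  (forall k i, 0 <= w k i) -> (forall k, \sum_i w k i = 1) ->
  (forall f : 'I_n -> I, rad (fun k => v k (f k)) <= D) ->
  rad (fun k => \sum_i (w k i)%:C *: v k i) <= D.
Proof.
move=> w0 w1 hD.
have key m : (m <= n)%N -> forall f : 'I_n -> I,
    rad (fun k : 'I_n => if (k < m)%N then \sum_i (w k i)%:C *: v k i
                         else v k (f k)) <= D.
  elim: m => [|m IH] lemn f; first exact: hD.
  pose km := Ordinal lemn.
  pose g i (k : 'I_n) := if k == km then i else f k.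
  pose z i (k : 'I_n) := if (k < m)%N then \sum_i (w k i)%:C *: v k i
                         else v k (g i k).
  rewrite (@eq_Rademacher _ _ (fun k => \sum_i (w km i)%:C *: z i k)).
    apply: le_trans (Rademacher_sum _ _) _.
    rewrite -[D]mul1r -(w1 km) mulr_suml; apply: ler_sum => i _.
    rewrite RademacherZ rnorm_real ger0_norm //.
    by rewrite ler_wpM2l // IH // ltnW.
  move=> k; rewrite /z /g ltnS leq_eqVlt.
  have [->|nk] := eqVneq k km; first by rewrite eqxx /= ltnn.
  have -> /= : (k == m :> nat) = false by apply/negbTE.
  rewrite -scaler_suml -rmorph_sum w1 scale1r; by case: ifP.
case: n w v w0 w1 hD key => [|n] w v w0 w1 hD key.
  rewrite (@eq_Rademacher _ _ (fun k => 0)); last by case.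
  apply: le_trans (Rademacher_le_sum _) _; rewrite big_ord0.
  have f0 : 'I_0 -> I by case.
  exact: le_trans (Rademacher_ge0 _) (hD f0).
have [i0 _] : exists i0 : I, true.
  case: (pickP (@predT I)) => [i _|no]; first by exists i.
  have := w1 ord0; rewrite big_pred0 // => /esym/eqP; by rewrite oner_eq0.
apply: le_trans (key n.+1 (leqnn _) (fun=> i0)).
rewrite le_eqVlt; apply/orP; left; apply/eqP/eq_Rademacher => k.
by rewrite ltn_ord.
Qed.

(** After division by [M], each sum is a convex combination of the vectors [+v] and [-v]. The
    missing mass [s k] is spread evenly over all signed vectors, where it cancels; this spreading
    divides by [N.+1]. *)
Lemma Rademacher_real_hull n N (a : 'I_n -> 'I_N.+1 -> R)
    (v : 'I_n -> 'I_N.+1 -> X) (M D : R) :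
  0 < M -> (forall k, \sum_j `|a k j| <= M) ->
  (forall f : 'I_n -> 'I_N.+1, rad (fun k => v k (f k)) <= D) ->
  rad (fun k => \sum_j (a k j)%:C *: v k j) <= M * D.
Proof.
move=> M0 aM hD.
pose s k := 1 - (\sum_j `|a k j|) / M.
pose w k (i : bool * 'I_N.+1) :=
  (`|a k i.2| + (-1) ^+ i.1 * a k i.2) / (2 * M) + s k / (2 * N.+1%:R).
pose u k (i : bool * 'I_N.+1) := (-1) ^+ i.1 *: v k i.2.
have s0 k : 0 <= s k by rewrite subr_ge0 ler_pdivrMr // mul1r.
have N0 : (N.+1%:R : R) != 0 by rewrite pnatr_eq0.
have w0 k i : 0 <= w k i.
  apply: addr_ge0; apply: divr_ge0 => //; last by rewrite mulr_ge0 // ltW.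
  case: i => [[] j] /=; rewrite ?expr1 ?expr0 ?mulN1r ?mul1r.
    by rewrite subr_ge0 ler_norm.
  by rewrite -[a k j]opprK subr_ge0 normrN ler_norm.
have w1 k : \sum_i w k i = 1.
  rewrite -(pair_bigA _ (fun b j => w k (b, j))) big_bool /= -big_split /=.
  transitivity (\sum_j (`|a k j| / M + s k / N.+1%:R)).
    apply: eq_bigr => j _; rewrite /w /= expr1 expr0.
    move: (N.+1%:R : R) N0 => c c0; field; by rewrite c0 gt_eqF.
  rewrite big_split /= -mulr_suml sumr_const card_ord -[X in _ + X]mulr_natr.
  by rewrite divfK // /s addrC subrK.
have hu (f : 'I_n -> bool * 'I_N.+1) : rad (fun k => u k (f k)) <= D.
  by rewrite (Rademacher_sign (fun k => (f k).1) (fun k => v k (f k).2)).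
have -> : rad (fun k => \sum_j (a k j)%:C *: v k j) =
          M * rad (fun k => \sum_i (w k i)%:C *: u k i).
  rewrite -[X in X * _](ger0_norm (ltW M0)) -rnorm_real -RademacherZ.
  apply: eq_Rademacher => k.
  rewrite -(pair_bigA _ (fun b j => (w k (b, j))%:C *: u k (b, j))) big_bool.
  rewrite /= -big_split scaler_sumr; apply: eq_bigr => j _ /=.
  rewrite /u /= expr1 expr0 !scalerA mulrN1 mulr1 -scalerDl scalerA.
  congr (_ *: _); rewrite -rmorphN -rmorphD -rmorphM; congr (_%:C).
  rewrite /w /= expr1 expr0.
  move: (N.+1%:R : R) N0 => c c0; field; by rewrite c0 gt_eqF.
by apply: ler_wpM2l; [exact: ltW | exact: Rademacher_convex].
Qed.

(** Real and imaginary parts of the coefficients are treated separately, at the cost of the factor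
    [2]. *)
Lemma Rademacher_hull n N (a : 'I_n -> 'I_N.+1 -> R[i])
    (v : 'I_n -> 'I_N.+1 -> X) (M D : R) :
  0 < M -> (forall k, \sum_j rnorm (a k j) <= M) ->
  (forall f : 'I_n -> 'I_N.+1, rad (fun k => v k (f k)) <= D) ->
  rad (fun k => \sum_j a k j *: v k j) <= 2 * M * D.
Proof.
move=> M0 aM hD.
rewrite (@eq_Rademacher _ _
  (fun k => \sum_j (complex.Re (a k j))%:C *: v k j +
            'i%C *: \sum_j (complex.Im (a k j))%:C *: v k j)); last first.
  move=> k; rewrite scaler_sumr -big_split; apply: eq_bigr => j _ /=.
  by rewrite scalerA -scalerDl -complexE.
apply: le_trans (RademacherD _ _) _; rewrite RademacherZ rnormi mul1r.
rewrite -mulrA mulr_natl mulr2n.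
by apply: lerD; apply: Rademacher_real_hull => // k;
  apply: le_trans (aM k); apply: ler_sum => j _;
  rewrite ?ler_Re_rnorm ?ler_Im_rnorm.
Qed.

(** Kahane's contraction principle, as the case of hulls with a single vector. *)
Lemma Rademacher_contraction n (a : 'I_n -> R[i]) (x : 'I_n -> X) (M : R) :
  0 < M -> (forall k, rnorm (a k) <= M) ->
  rad (fun k => a k *: x k) <= 2 * M * rad x.
Proof.
move=> M0 aM.
have := @Rademacher_hull n 0 (fun k _ => a k) (fun k _ => x k) M (rad x) M0.
rewrite (@eq_Rademacher _ (fun k => \sum_(j < 1) _) (fun k => a k *: x k));
  last by move=> k; rewrite big_ord_recl big_ord0 addr0.
by apply=> // k; rewrite big_ord_recl big_ord0 addr0.
Qed.

End Rademacher.

(** * Resolvents near the unit circle *)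

Section LinearMaps.
Variables (R : realType) (X : completeNormedModType R[i]).
Implicit Types (S T G : X -> X) (x y : X) (C q : R).

Definition to_linear S (S_lin : linear S) : {linear X -> X} :=
  HB.pack S (GRing.isLinear.Build R[i] X X *:%R S S_lin).

Lemma linear_map0 S : linear S -> S 0 = 0.
Proof. by move=> h; exact: (raddf0 (to_linear h)). Qed.

Lemma linear_mapD S x y : linear S -> S (x + y) = S x + S y.
Proof. by move=> h; exact: (raddfD (to_linear h)). Qed.

Lemma linear_mapB S x y : linear S -> S (x - y) = S x - S y.
Proof. by move=> h; exact: (raddfB (to_linear h)). Qed.

Lemma linear_mapZ S a x : linear S -> S (a *: x) = a *: S x.
Proof. by move=> h; exact: (linearZ_LR (to_linear h)). Qed.

Lemma linear_map_sum S (I : Type) (r : seq I) (P : pred I) (F : I -> X) :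
  linear S -> S (\sum_(i <- r | P i) F i) = \sum_(i <- r | P i) S (F i).
Proof. by move=> h; exact: (raddf_sum (to_linear h)). Qed.

Lemma linear_iter S n : linear S -> linear (iter n S).
Proof. by move=> h; elim: n => [|n IH] a x y //=; rewrite IH h. Qed.

Lemma linear_scale S a : linear S -> linear (fun x => a *: S x).
Proof.
by move=> h b x y; rewrite h scalerDr !scalerA mulrC.
Qed.

Lemma opnorm_le S C :
  0 <= C -> (forall x, rnorm (S x) <= C * rnorm x) -> (opnorm S <= C%:E)%E.
Proof.
move=> C0 h; apply: ge_ereal_sup => _ [x /= x1 <-].
by rewrite lee_fin (le_trans (h x)) // ler_piMr.
Qed.

Lemma opnorm_bound S C x :
  linear S -> (opnorm S <= C%:E)%E -> rnorm (S x) <= C * rnorm x.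
Proof.
move=> Slin h; have [->|x0] := eqVneq x 0.
  by rewrite linear_map0 // rnorm0 mulr0.
have nx0 : 0 < rnorm x by rewrite rnorm_gt0.
pose z := (rnorm x)^-1%:C *: x.
have nz : rnorm z = 1.
  by rewrite rnormZ rnorm_real ger0_norm ?invr_ge0 ?ltW // mulVf ?gt_eqF.
have : rnorm (S z) <= C.
  rewrite -lee_fin; apply: le_trans h; apply: ereal_sup_ubound.
  by exists z => //=; rewrite nz.
rewrite linear_mapZ // rnormZ rnorm_real ger0_norm; last first.
  by rewrite invr_ge0 ltW.
by rewrite mulrC ler_pdivrMr.
Qed.

Lemma bounded_operatorP S :
  bounded_operator S <->
  linear S /\ exists C, 0 <= C /\ forall x, rnorm (S x) <= C * rnorm x.
Proof.
split=> [[Slin Sb]|[Slin [C [C0 h]]]]; split => //; last first.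
  by apply: le_lt_trans (opnorm_le C0 h) _; rewrite ltry.
have o0 : (0 <= opnorm S)%E.
  apply: ereal_sup_ubound; exists 0; rewrite /= ?rnorm0 //.
  by rewrite linear_map0 // rnorm0.
exists (fine (opnorm S)); split; first exact: fine_ge0.
move=> x; apply: opnorm_bound => //.
by rewrite fineK // ge0_fin_numE.
Qed.

Lemma complete_geometric (u : nat -> X) C q :
  0 <= q < 1 -> (forall n, rnorm (u n.+1 - u n) <= C * q ^+ n) ->
  exists l, forall e, 0 < e -> exists N, forall n, (N <= n)%N ->
    rnorm (u n - l) < e.
Proof.
move=> /andP[q0 q1] uq.
have q1' : 0 < 1 - q by rewrite subr_gt0.
have C0 : 0 <= C.
  by have := le_trans (rnorm_ge0 _) (uq 0%N); rewrite expr0 mulr1.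
have dist n p : rnorm (u (n + p)%N - u n) <= C / (1 - q) * q ^+ n.
  (* With the exact geometric sum on the right, the induction on [p] closes with equality. *)
  have : rnorm (u (n + p)%N - u n) <= C / (1 - q) * (q ^+ n - q ^+ (n + p)).
    elim: p => [|p IH]; first by rewrite addn0 !subrr rnorm0 mulr0.
    rewrite addnS -(subrK (u (n + p)%N) (u _.+1)) -addrA.
    apply: le_trans (ler_rnormD _ _) _; apply: le_trans (lerD (uq _) IH) _.
    rewrite le_eqVlt; apply/orP; left; apply/eqP; rewrite exprS; field.
    by rewrite gt_eqF.
  move=> h; apply: le_trans h _; apply: ler_wpM2l.
    by rewrite divr_ge0 // ltW.
  by rewrite gerBl exprn_ge0.
have small e : 0 < e -> exists N, C / (1 - q) * q ^+ N < e.
  move=> e0; have := @cvg_geometric R (C / (1 - q)) q.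
  rewrite ger0_norm // => /(_ q1) /cvgrPdist_lt /(_ e e0) [N _ /(_ N)] /=.
  rewrite leqnn => /(_ isT) h; exists N; move: h; rewrite sub0r normrN.
  by apply: le_lt_trans; exact: ler_norm.
have : cvg (u @ \oo).
  apply: cauchy_cvg; apply: cauchy_exP => e e0.
  have eR : e = (complex.Re e)%:C by rewrite RRe_real // gtr0_real.
  have e0' : 0 < complex.Re e by rewrite -ltcR -eR.
  have [N hN] := small _ e0'; exists (u N).
  exists N => // n /= Nn; rewrite -ball_normE /= eR -rnormE ltcR.
  by rewrite rnormBC -(subnKC Nn) (le_lt_trans (dist _ _)).
move=> /cvg_ex[l ul]; exists l => e e0.
have ec0 : 0 < e%:C :> R[i] by rewrite ltcR.
have [N _ hN] := (@cvgrPdist_lt R[i] X nat \oo _ u l).1 ul _ ec0.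
exists N => n /hN /=; by rewrite -rnormE ltcR rnormBC.
Qed.

(** The iterates of [y -> x + G y] from [0] are the partial sums of the Neumann series; their limit
    is the solution. *)
Lemma Neumann_surj G q x :
  linear G -> 0 <= q < 1 -> (forall x, rnorm (G x) <= q * rnorm x) ->
  exists y, y - G y = x.
Proof.
move=> Glin q01 Gq; have /andP[q0 q1] := q01.
pose u n := iter n (fun y => x + G y) 0.
have du n : rnorm (u n.+1 - u n) <= rnorm x * q ^+ n.
  elim: n => [|n IH]; first by rewrite /u /= linear_map0 // addr0 subr0 mulr1.
  rewrite /u iterS [iter n.+1 _ _ in X in _ - X]iterS -/(u n.+1) -/(u n).
  rewrite opprD addrACA subrr add0r -linear_mapB //.
  by rewrite (le_trans (Gq _)) // exprS mulrCA ler_wpM2l.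
have [y hy] := complete_geometric q01 du; exists y.
apply/eqP; rewrite -subr_eq0 -rnorm_eq0 eq_le rnorm_ge0 andbT.
apply/ler_addgt0Pl => e e0; rewrite addr0.
have e20 : 0 < e / 2 by rewrite divr_gt0.
have [N hN] := hy _ e20.
have -> : y - G y - x = (y - u N.+1) + G (u N - y).
  by rewrite /u iterS -/(u N) linear_mapB // opprD addrA addrA subrK addrAC.
apply: le_trans (ler_rnormD _ _) _; rewrite [e]splitr; apply: lerD.
  by rewrite rnormBC ltW // hN.
apply: le_trans (Gq _) _; apply: le_trans (ltW (hN N (leqnn N))).
by rewrite ler_piMl ?rnorm_ge0 // ltW.
Qed.

(** [V] is chosen pointwise. The lower bound [inj] gives uniqueness of solutions, hence linearity of
    [V], and also its bound [(1 - q)^-1]. *)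
Lemma Neumann_inverse G q :
  linear G -> 0 <= q < 1 -> (forall x, rnorm (G x) <= q * rnorm x) ->
  exists V, [/\ bounded_operator V, cancel (fun x => x - G x) V &
                cancel V (fun x => x - G x)].
Proof.
move=> Glin q01 Gq; have /andP[q0 q1] := q01.
have inj y : rnorm y <= (1 - q)^-1 * rnorm (y - G y).
  rewrite mulrC ler_pdivlMr ?subr_gt0 // mulrBr mulr1 lerBlDl mulrC.
  apply: le_trans (ler_rnorm_dist y (G y)) _.
  by rewrite lerD2r Gq.
have injE y z : y - G y = z - G z -> y = z.
  move=> h; apply/eqP; rewrite -subr_eq0 -rnorm_eq0 eq_le rnorm_ge0 andbT.
  apply: le_trans (inj _) _.
  by rewrite linear_mapB // opprD addrACA -opprD h subrr rnorm0 mulr0.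
have [V hV] := choice (fun x => Neumann_surj x Glin q01 Gq).
exists V; split => //; last by move=> x; apply: injE; rewrite hV.
apply/bounded_operatorP; split.
  move=> a x y; apply: injE; rewrite hV linear_mapD // linear_mapZ //.
  by rewrite opprD addrACA -scalerBr !hV.
exists (1 - q)^-1; split; first by rewrite invr_ge0 subr_ge0 ltW.
by move=> x; rewrite -{2}(hV x).
Qed.

End LinearMaps.

(** * Resolvents of [r T] on and slightly inside the circle of radius [r] *)

Section Resolvents.
Variables (R : realType) (X : completeNormedModType R[i]).
Implicit Types (A U V : X -> X) (l mu : R[i]) (r : R).

Lemma resolventP A l U : is_resolvent A l U -> is_resolvent A l (resolvent A l).
Proof. by move=> h; rewrite /resolvent; apply: xgetPex; exists U. Qed.

Lemma resolvent_uniq A l U V : is_resolvent A l U -> is_resolvent A l V -> U =1 V.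
Proof. by move=> [_ hU _] [_ _ hV] x; rewrite -{1}(hV x) hU. Qed.

Lemma is_resolvent_zero A l :
  l != 0 -> is_resolvent (fun x => 0%:C *: A x) l (fun x => l^-1 *: x).
Proof.
move=> l0; split.
- apply/bounded_operatorP; split.
    by move=> a x y; rewrite scalerDr !scalerA mulrC.
  exists (rnorm l^-1); split; first exact: rnorm_ge0.
  by move=> x; rewrite rnormZ.
- by move=> x; rewrite scale0r subr0 scalerA mulVf // scale1r.
- by move=> x; rewrite scale0r subr0 scalerA mulfV // scale1r.
Qed.

Variables (T : X -> X) (T_lin : linear T).

Local Notation scaled r := (fun x : X => r%:C *: T x).

(** Scaling: with [l = mu / r], [R(mu, r T) = r^-1 R(l, T)], hence
    [(mu - r) R(mu, r T) = (l - 1) R(l, T)]. All bounds are therefore uniform in [r]. *)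
Lemma Ritt_resolvent r mu : spectrum T `<=` [set l | rnorm l <= 1] ->
  0 < r -> r < rnorm mu ->
  exists U B, [/\ is_resolvent (scaled r) mu U, Ritt_set T B &
                  forall x, B x = (mu - r%:C) *: U x].
Proof.
move=> specT r0 rmu.
have rC0 : r%:C != 0 :> R[i] by rewrite (fmorph_eq0 (@real_complex R)) gt_eqF.
pose l := mu / r%:C.
have l1 : 1 < rnorm l.
  by rewrite /l rnormM rnormV rnorm_real (gtr0_norm r0) ltr_pdivlMr // mul1r.
have [S hS] : exists S, is_resolvent T l S.
  apply: contrapT => h; have := specT l h; rewrite /= leNgt; exact/negP/negPn.
have [/bounded_operatorP [Rlin [C [C0 RC]]] RK KR] := resolventP hS.
exists (fun x => r%:C^-1 *: resolvent T l x).
exists (fun x => (l - 1) *: resolvent T l x); split; last 2 first.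
- by exists l.
- by move=> x; rewrite scalerA mulrBl mulfV.
have e x : mu *: x - r%:C *: T x = r%:C *: (l *: x - T x).
  by rewrite scalerBr scalerA /l mulrC divfK.
split.
- apply/bounded_operatorP; split; first exact: linear_scale.
  exists (rnorm r%:C^-1 * C); split; first by rewrite mulr_ge0 ?rnorm_ge0.
  by move=> x; rewrite rnormZ -mulrA ler_wpM2l ?rnorm_ge0.
- by move=> x; rewrite e linear_mapZ // RK scalerA mulVf // scale1r.
- move=> x; rewrite e (linear_mapZ _ _ T_lin) [l *: _]scalerA [l * _]mulrC -scalerA.
  by rewrite -scalerBr KR scalerA mulfV // scale1r.
Qed.

Lemma R_bounded_singleton (F : set (X -> X)) (C : R) S x :
  (forall n (S : 'I_n -> X -> X) (x : 'I_n -> X), (forall j, F (S j)) ->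
     Rademacher_mean (fun j => S j (x j)) <= C * Rademacher_mean x) ->
  F S -> rnorm (S x) <= C * rnorm x.
Proof.
move=> h FS; have := h 1%N (fun=> S) (fun=> x) (fun=> FS).
by rewrite !Rademacher1.
Qed.

(* [B] is [(mu - r) R(mu, r T)] for some [mu] with [|mu| > r] close to [l], and
   [Y] is [(mu - r) R(l, r T)]. *)
Lemma region_resolvent (C0 c r : R) l :
  spectrum T `<=` [set l | rnorm l <= 1] ->
  1 <= C0 -> c = (16 * C0)^-1 ->
  (forall S x, Ritt_set T S -> rnorm (S x) <= C0 * rnorm x) ->
  0 < r -> l != r%:C -> r - rnorm l <= c * rnorm (l - r%:C) ->
  exists U, is_resolvent (scaled r) l U /\
  exists Y B k s, [/\ Ritt_set T B, rnorm k <= 4 * c, rnorm s <= 2,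
    forall x, Y x = B x + k *: B (Y x) & forall x, (l - r%:C) *: U x = s *: Y x].
Proof.
move=> specT C01 cE boundB r0 lr hl.
have C0_gt0 : 0 < C0 by apply: lt_le_trans C01.
have c_gt0 : 0 < c by rewrite cE invr_gt0 mulr_gt0.
have cC : c * C0 = 16^-1 by rewrite cE; field; rewrite gt_eqF.
have c16 : c <= 16^-1 by rewrite -cC ler_peMr // ltW.
pose d := rnorm (l - r%:C).
have d_gt0 : 0 < d by rewrite rnorm_gt0 subr_eq0.
have nl0 : 0 < rnorm l.
  rewrite rnorm_gt0; apply/negP => /eqP l0.
  move: hl; rewrite l0 rnorm0 subr0 sub0r rnormN rnorm_real (gtr0_norm r0).
  by nra.
(* [mu] is [l] pushed radially outwards by [2 c d]; the hypothesis says that [l] is at most [c d]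
   inside the circle of radius [r], so [|mu| > r]. *)
pose t := 2 * c * d / rnorm l.
have t0 : 0 <= t by rewrite !mulr_ge0 ?invr_ge0 // ltW.
pose mu := (1 + t%:C) * l.
have mul : mu - l = t%:C * l by rewrite /mu mulrDl mul1r addrC addKr.
have nmul : rnorm (mu - l) = 2 * c * d.
  by rewrite mul rnormM rnorm_real ger0_norm // /t divfK // gt_eqF.
have nmu : rnorm mu = rnorm l + 2 * c * d.
  rewrite /mu rnormM -(rmorph1 (@real_complex R)) -rmorphD rnorm_real ger0_norm.
    by rewrite mulrDl mul1r /t divfK // gt_eqF.
  by rewrite addr_ge0.
clearbody mu.
have rmu : r < rnorm mu by rewrite nmu; rewrite -/d in hl; nra.
have mur : d / 2 <= rnorm (mu - r%:C).
  have := ler_rnorm_dist (l - r%:C) (mu - r%:C); rewrite -/d.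
  rewrite opprB addrA subrK (rnormBC l) nmul; nra.
have mur0 : mu - r%:C != 0 by rewrite -rnorm_gt0; apply: lt_le_trans mur; lra.
have nmur0 : 0 < rnorm (mu - r%:C) by rewrite rnorm_gt0.
have [Um [B [[/bounded_operatorP [Ulin [CU [CU0 hCU]]] UK KU] RB BU]]] :=
  Ritt_resolvent specT r0 rmu.
pose k := (mu - l) / (mu - r%:C).
have nk : rnorm k <= 4 * c.
  rewrite /k rnormM rnormV ler_pdivrMr // nmul; nra.
pose G x := (mu - l) *: Um x.
have GE x : G x = k *: B x by rewrite BU scalerA /k divfK.
have Glin : linear G by apply: linear_scale.
(* The choice of [c] gives [4 c C0 = 1/4]. *)
have Gq x : rnorm (G x) <= 4^-1 * rnorm x.
  rewrite GE rnormZ; have := boundB _ x RB; have := rnorm_ge0 x.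
  have := rnorm_ge0 k; have := rnorm_ge0 (B x).
  move: (rnorm k) (rnorm (B x)) (rnorm x) nk => a b e nk b0 a0 e0 be.
  apply: le_trans (ler_pM a0 b0 nk be) _.
  rewrite mulrACA -mulrA; nra.
have q01 : 0 <= (4^-1 : R) < 1.
  by rewrite invr_ge0 ler0n invf_lt1 ?ltr1n.
have [V [/bounded_operatorP [Vlin [CV [CV0 hCV]]] VK KV]] :=
  Neumann_inverse Glin q01 Gq.
have shift x :
    l *: x - r%:C *: T x = (mu *: x - r%:C *: T x) - (mu - l) *: x.
  by rewrite scalerBl opprB [RHS]addrC addrA subrK.
(* [l - r T = (mu - r T) - (mu - l)], so [R(l, r T) = (1 - G)^-1 R(mu, r T)]. *)
exists (V \o Um); split.
  split.
  - apply/bounded_operatorP; split; first by move=> a x y /=; rewrite Ulin Vlin.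
    exists (CV * CU); split; first exact: mulr_ge0.
    by move=> x; apply: le_trans (hCV _) _; rewrite -mulrA ler_wpM2l.
  - move=> x /=; rewrite -[RHS](VK x); congr V.
    by rewrite shift (linear_mapB _ _ Ulin) UK (linear_mapZ _ _ Ulin).
  - move=> x /=; set y := V _.
    have GG : mu *: G y - r%:C *: T (G y) = (mu - l) *: y.
      rewrite /G (linear_mapZ _ _ T_lin) !scalerA ![_ * (mu - l)]mulrC -!scalerA.
      by rewrite -scalerBr KU.
    rewrite shift -GG -[RHS]KU -(KV (Um x)) -/y (linear_mapB _ _ T_lin).
    rewrite !scalerBr !opprB -![_ - r%:C *: T y]addrC addrACA.
    exact: addrC.
exists (fun x => (mu - r%:C) *: V (Um x)), B, k, ((l - r%:C) / (mu - r%:C)).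
split => //.
- rewrite rnormM rnormV ler_pdivrMr // -/d; lra.
- move=> x; rewrite -[V (Um x) in LHS](subrK (G (V (Um x)))) KV.
  by rewrite scalerDr -BU GE scalerA [_ * k]mulrC -scalerA !BU (linear_mapZ _ _ Ulin).
- by move=> x; rewrite scalerA divfK.
Qed.

(** The Neumann series is not summed: the fixed-point identity [Y = B + k B Y] is put inside the
    Rademacher mean, and [c] is small enough for the term in [Y] to be absorbed on the left. *)
Lemma region_R_bounded (C0 c r : R) n (l : 'I_n -> R[i]) (U : 'I_n -> X -> X)
    (x : 'I_n -> X) :
  spectrum T `<=` [set l | rnorm l <= 1] ->
  1 <= C0 -> c = (16 * C0)^-1 ->
  (forall n (S : 'I_n -> X -> X) (x : 'I_n -> X), (forall j, Ritt_set T (S j)) ->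
     Rademacher_mean (fun j => S j (x j)) <= C0 * Rademacher_mean x) ->
  0 < r -> (forall j, l j != r%:C) ->
  (forall j, r - rnorm (l j) <= c * rnorm (l j - r%:C)) ->
  (forall j, is_resolvent (scaled r) (l j) (U j)) ->
  Rademacher_mean (fun j => (l j - r%:C) *: U j (x j))
    <= 8 * C0 * Rademacher_mean x.
Proof.
move=> specT C01 cE RC0 r0 lr hl hU.
have C0_gt0 : 0 < C0 by apply: lt_le_trans C01.
have cC : c * C0 = 16^-1 by rewrite cE; field; rewrite gt_eqF.
have c_gt0 : 0 < c by rewrite cE invr_gt0 mulr_gt0.
have bd S y := @R_bounded_singleton _ C0 S y RC0.
have /choice [f hf] : forall j, exists p : (X -> X) * (X -> X) * R[i] * R[i],
    [/\ Ritt_set T p.1.1.2, rnorm p.1.2 <= 4 * c, rnorm p.2 <= 2,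
      forall x, p.1.1.1 x = p.1.1.2 x + p.1.2 *: p.1.1.2 (p.1.1.1 x) &
      forall x, (l j - r%:C) *: U j x = p.2 *: p.1.1.1 x].
  move=> j; have [V [hV [Y [B [k [s [hB hk hs hY hYs]]]]]]] :=
    region_resolvent specT C01 cE bd r0 (lr j) (hl j).
  exists (Y, B, k, s); split => //= z.
  by rewrite (resolvent_uniq (hU j) hV).
pose Y j := (f j).1.1.1 (x j).
have -> : Rademacher_mean (fun j => (l j - r%:C) *: U j (x j)) =
          Rademacher_mean (fun j => (f j).2 *: Y j).
  by apply: eq_Rademacher => j; case: (hf j).
have h2 : Rademacher_mean (fun j => (f j).2 *: Y j) <= 2 * 2 * Rademacher_mean Y.
  by apply: Rademacher_contraction => // j; case: (hf j).
have hY : Rademacher_mean Y <=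
    C0 * Rademacher_mean x + 2 * (4 * c) * (C0 * Rademacher_mean Y).
  rewrite [X in X <= _](@eq_Rademacher _ _ _ Y (fun j => (f j).1.1.2 (x j) +
     (f j).1.2 *: (f j).1.1.2 (Y j))); last by move=> j; case: (hf j) => _ _ _ + _; apply.
  apply: le_trans (RademacherD _ _) _; apply: lerD.
    by apply: (RC0 _ (fun j => (f j).1.1.2) x) => j; case: (hf j).
  apply: le_trans (@Rademacher_contraction _ _ _ _ _ (4 * c) _ _) _.
  - by rewrite mulr_gt0.
  - by move=> j; case: (hf j).
  rewrite ler_pM2l; last by rewrite !mulr_gt0.
  by apply: (RC0 _ (fun j => (f j).1.1.2) Y) => j; case: (hf j).
have e : 2 * (4 * c) * (C0 * Rademacher_mean Y) = 2^-1 * Rademacher_mean Y.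
  rewrite [LHS](_ : _ = 8 * (c * C0) * Rademacher_mean Y); last by ring.
  by rewrite cC; field.
(* [hY] now bounds the mean of [Y] by half of itself plus [C0] times the mean of
   [x]. *)
rewrite e in hY; nra.
Qed.

Lemma region_bound (C0 c r : R) (l : R[i]) (U : X -> X) (x : X) :
  spectrum T `<=` [set l | rnorm l <= 1] ->
  1 <= C0 -> c = (16 * C0)^-1 ->
  (forall n (S : 'I_n -> X -> X) (x : 'I_n -> X), (forall j, Ritt_set T (S j)) ->
     Rademacher_mean (fun j => S j (x j)) <= C0 * Rademacher_mean x) ->
  0 < r -> l != r%:C -> r - rnorm l <= c * rnorm (l - r%:C) ->
  is_resolvent (scaled r) l U ->
  rnorm (l - r%:C) * rnorm (U x) <= 8 * C0 * rnorm x.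
Proof.
move=> specT C01 cE RC0 r0 lr hl hU; rewrite -rnormZ -!Rademacher1.
exact: (@region_R_bounded C0 c r 1 (fun=> l) (fun=> U) (fun=> x)).
Qed.

End Resolvents.

(** * Riemann sums of resolvents *)

Section PolynomialCalculus.
Variables (R : realType) (X : completeNormedModType R[i]).
Variables (T : X -> X) (T_lin : linear T).
Implicit Types (P Q : {poly R[i]}) (x y : X).

Lemma poly_opE P n x : (size P <= n)%N ->
  poly_op P T x = \sum_(k < n) P`_k *: iter k T x.
Proof.
move=> Pn; rewrite /poly_op (big_ord_widen n (fun k => P`_k *: iter k T x)) //.
rewrite big_mkcond; apply: eq_bigr => k _; case: ltnP => // h.
by rewrite nth_default // scale0r.
Qed.

Lemma poly_opD P Q x : poly_op (P + Q) T x = poly_op P T x + poly_op Q T x.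
Proof.
pose n := maxn (size P) (size Q).
rewrite (@poly_opE _ n) ?size_polyD // (@poly_opE P n) ?leq_maxl //.
rewrite (@poly_opE Q n) ?leq_maxr // -big_split; apply: eq_bigr => k _.
by rewrite coefD scalerDl.
Qed.

Lemma poly_opZ c P x : poly_op (c *: P) T x = c *: poly_op P T x.
Proof.
rewrite (@poly_opE _ (size P)) ?size_scale_leq // scaler_sumr.
by apply: eq_bigr => k _; rewrite coefZ scalerA.
Qed.

Lemma poly_op0 x : poly_op 0 T x = 0.
Proof. by rewrite (@poly_opE _ 0) ?size_poly0 // big_ord0. Qed.

Lemma poly_opB P Q x : poly_op (P - Q) T x = poly_op P T x - poly_op Q T x.
Proof. by rewrite poly_opD -scaleN1r poly_opZ scaleN1r. Qed.

Lemma poly_op_sum (I : Type) (r : seq I) (F : I -> {poly R[i]}) x :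
  poly_op (\sum_(i <- r) F i) T x = \sum_(i <- r) poly_op (F i) T x.
Proof.
elim: r => [|i r IH]; first by rewrite !big_nil poly_op0.
by rewrite !big_cons poly_opD IH.
Qed.

Lemma poly_opC c x : poly_op c%:P T x = c *: x.
Proof. by rewrite (@poly_opE _ 1) ?size_polyC_leq1 // big_ord1 coefC. Qed.

Lemma poly_opMX P x : poly_op (P * 'X) T x = poly_op P T (T x).
Proof.
rewrite (@poly_opE _ (size P).+1); last first.
  by apply: leq_trans (size_polyMleq _ _) _; rewrite size_polyX addn2.
rewrite big_ord_recl coefMX eqxx scale0r add0r; apply: eq_bigr => k _.
by rewrite coefMX lift0 /= -iterS iterSr.
Qed.

Lemma poly_opXn n x : poly_op 'X^n T x = iter n T x.
Proof.
elim: n x => [|n IH] x; first by rewrite expr0 -polyC1 poly_opC scale1r.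
by rewrite exprSr poly_opMX IH -iterSr.
Qed.

Lemma linear_poly_op P : linear (poly_op P T).
Proof.
move=> a x y; rewrite /poly_op scaler_sumr -big_split; apply: eq_bigr => k _ /=.
by rewrite (linear_iter _ T_lin) scalerDr !scalerA mulrC.
Qed.

Lemma poly_op_comm P x : poly_op P T (T x) = T (poly_op P T x).
Proof.
rewrite /poly_op linear_map_sum //; apply: eq_bigr => k _.
by rewrite (linear_mapZ _ _ T_lin) -iterSr.
Qed.

Lemma poly_opM P Q x : poly_op (P * Q) T x = poly_op P T (poly_op Q T x).
Proof.
elim/poly_ind: P x => [|P c IH] x; first by rewrite mul0r !poly_op0.
have -> : (P * 'X + c%:P) * Q = P * Q * 'X + c *: Q by rewrite -mul_polyC; ring.
by rewrite !poly_opD poly_opZ !poly_opMX IH poly_opC poly_op_comm.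
Qed.

End PolynomialCalculus.

(** Most passages to the limit below take this form, with an error [c / (n + 1)] whose constant may
    depend on everything but [n]. *)
Lemma ler_addr_invn (R : realType) (a b c : R) :
  (forall n : nat, a <= b + c / n.+1%:R) -> a <= b.
Proof.
move=> h; have hc n : a <= b + `|c| / n.+1%:R.
  apply: le_trans (h n) _; rewrite lerD2l ler_wpM2r ?ler_norm //.
apply/ler_addgt0Pl => e e0.
have [m hm] : exists m : nat, `|c| / e < m%:R.
  exists (Num.bound (`|c| / e)); apply: archi_boundP; rewrite divr_ge0 //.
  exact: ltW.
apply: le_trans (hc m) _; rewrite addrC lerD2r ler_pdivrMr //.
have m1 : (m%:R : R) <= m.+1%:R by rewrite ler_nat.
rewrite mulrC -ler_pdivrMr //; exact: le_trans (ltW hm) m1.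
Qed.

(** * Riemann sums of resolvents along a closed sequence of points *)

Section RiemannSums.
Variables (R : realType) (X : completeNormedModType R[i]).
Variables (T : X -> X) (T_lin : linear T).

Local Notation scaled r := (fun x : X => r%:C *: T x).
Local Notation res r l := (resolvent (scaled r) l).

(** The resolvent identity with both the spectral parameter and the scaling of [T] allowed to
    vary. *)
Lemma resolvent_identity (r r' : R) (l l' : R[i]) (U U' : X -> X) x :
  is_resolvent (scaled r) l U -> is_resolvent (scaled r') l' U' ->
  U x - U' x = (l' - l) *: U (U' x) + (r - r')%:C *: U (T (U' x)).
Proof.
move=> [/bounded_operatorP [Ulin _] UK _] [_ _ KU'].
have e1 : U x = U (l' *: U' x - r'%:C *: T (U' x)) by rewrite KU'.
have e2 : U' x = U (l *: U' x - r%:C *: T (U' x)) by rewrite UK.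
rewrite e1 [X in _ - X = _]e2 -(linear_mapB _ _ Ulin).
rewrite -2!(linear_mapZ _ _ Ulin) -(linear_mapD _ _ Ulin); congr U.
rewrite opprD opprK addrACA -scalerBl; congr (_ + _).
by rewrite rmorphB scalerBl addrC.
Qed.

Lemma resolvent_commute (r : R) (l : R[i]) (U : X -> X) x :
  is_resolvent (scaled r) l U -> U (T x) = T (U x).
Proof.
move=> [_ UK KU]; rewrite -{1}(KU x) (linear_mapB _ _ T_lin).
by rewrite !(linear_mapZ _ _ T_lin) UK.
Qed.

Variables (tau D L : R) (N : nat) (l : nat -> R[i]) (h r : R).
Hypotheses (T_bound : forall x, rnorm (T x) <= tau * rnorm x) (tau0 : 0 <= tau).
Hypotheses (D0 : 0 <= D) (h0 : 0 <= h) (NhL : N%:R * h <= L).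
Hypotheses (closed_l : l N = l 0%N) (l_neq0 : forall j, l j != 0).
Hypotheses (l_le1 : forall j, rnorm (l j) <= 1).
Hypotheses (l_step : forall j, rnorm (l j.+1 - l j) <= h).
Hypotheses (r01 : 0 <= r <= 1).
Hypothesis resP : forall (s : R) j, 0 <= s <= r ->
  is_resolvent (scaled s) (l j) (res s (l j)).
Hypothesis res_bound : forall (s : R) j x, 0 <= s <= r ->
  rnorm (res s (l j) x) <= D * rnorm x.

Let L0 : 0 <= L.
Proof. by apply: le_trans NhL; rewrite mulr_ge0. Qed.

Let I s x := \sum_(j < N) (l j.+1 - l j) *: res s (l j) x.
Let K := L * D ^+ 3 * tau * (1 + tau).

Let K0 : 0 <= K.
Proof. by rewrite !mulr_ge0 ?exprn_ge0 ?addr_ge0. Qed.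

Lemma rnorm_sum_steps (F : nat -> X) c :
  (forall j, rnorm (F j) <= c) ->
  rnorm (\sum_(j < N) (l j.+1 - l j) *: F j) <= L * c.
Proof.
move=> hF; have c0 : 0 <= c by apply: le_trans (rnorm_ge0 _) (hF 0%N).
apply: le_trans (ler_rnorm_sum _ _ _) _.
apply: le_trans (_ : \sum_(j < N) h * c <= _).
  by apply: ler_sum => j _; rewrite rnormZ ler_pM ?rnorm_ge0.
by rewrite sumr_const card_ord -mulr_natl mulrA ler_wpM2r.
Qed.

(* [d/ds R(l, sT) = T R(l, sT)^2 = - d/dl (T R(l, sT))] integrates to zero along
   the closed contour. *)
Lemma homotopy_step (s s' : R) x : 0 <= s <= r -> 0 <= s' <= r ->
  rnorm (I s x - I s' x) <= K * `|s - s'| * (h + `|s - s'|) * rnorm x.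
Proof.
move=> hs hs'; pose y := T x.
(* By the resolvent identity the terms are differences of consecutive values, and the contour is
   closed. *)
have tel : \sum_(j < N) (l j.+1 - l j) *: res s (l j) (res s (l j.+1) y) = 0.
  transitivity (\sum_(j < N) (res s (l j) y - res s (l j.+1) y)).
    apply: eq_bigr => j _.
    rewrite (resolvent_identity y (resP j hs) (resP j.+1 hs)).
    by rewrite subrr scale0r addr0.
  rewrite -[LHS]opprK -sumrN.
  under eq_bigr do rewrite opprB.
  by rewrite -(big_mkord xpredT (fun j => res s (l j.+1) y - res s (l j) y))
    telescope_sumr // closed_l subrr oppr0.
(* Subtracting the null sum [tel] leaves a difference of resolvents of size [h + |s - s'|], so the
   error is of second order. *)
have -> : I s x - I s' x = (s - s')%:C *: \sum_(j < N) (l j.+1 - l j) *: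
    res s (l j) (res s' (l j) y - res s (l j.+1) y).
  transitivity ((s - s')%:C *:
      \sum_(j < N) (l j.+1 - l j) *: res s (l j) (res s' (l j) y)).
    rewrite /I -sumrB scaler_sumr; apply: eq_bigr => j _.
    rewrite -scalerBr (resolvent_identity x (resP j hs) (resP j hs')).
    rewrite subrr scale0r add0r -(resolvent_commute x (resP j hs')).
    by rewrite !scalerA mulrC.
  congr (_ *: _); rewrite -[LHS]subr0 -[X in _ - X]tel -sumrB.
  apply: eq_bigr => j _; have [/bounded_operatorP [Ulin _] _ _] := resP j hs.
  by rewrite (linear_mapB _ _ Ulin) scalerBr.
have yb : rnorm y <= tau * rnorm x := T_bound x.
have y0 := rnorm_ge0 y; have x0 := rnorm_ge0 x.
set d := `|s - s'|; have d0 : 0 <= d := normr_ge0 _.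
have diff j : rnorm (res s' (l j) y - res s (l j.+1) y)
    <= D ^+ 2 * (h + tau * d) * rnorm y.
  rewrite (resolvent_identity y (resP j hs') (resP j.+1 hs)).
  apply: le_trans (ler_rnormD _ _) _; rewrite !rnormZ.
  rewrite mulrDr mulrDl; apply: lerD.
    rewrite [D ^+ 2 * h]mulrC -mulrA; apply: ler_pM => //; try exact: rnorm_ge0.
    apply: le_trans (res_bound _ _ hs') _; rewrite expr2 -mulrA ler_wpM2l //.
    exact: res_bound.
  rewrite rnorm_real distrC -/d.
  have -> : D ^+ 2 * (tau * d) * rnorm y = d * (D * (tau * (D * rnorm y))).
    by ring.
  apply: ler_wpM2l => //; apply: le_trans (res_bound _ _ hs') _.
  apply: ler_wpM2l => //; apply: le_trans (T_bound _) _.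
  by apply: ler_wpM2l => //; apply: res_bound.
rewrite rnormZ rnorm_real -/d.
apply: le_trans (_ : d * (L * (D * (D ^+ 2 * (h + tau * d) * (tau * rnorm x))))
  <= _).
  apply: ler_wpM2l => //; 
  apply: (@rnorm_sum_steps (fun j => res s (l j)
    (res s' (l j) y - res s (l j.+1) y))) => j.
  apply: le_trans (res_bound _ _ hs) _; apply: ler_wpM2l => //.
  apply: le_trans (diff j) _; apply: ler_wpM2l => //.
  by rewrite mulr_ge0 ?exprn_ge0 ?addr_ge0 ?mulr_ge0.
have -> : d * (L * (D * (D ^+ 2 * (h + tau * d) * (tau * rnorm x)))) =
   (L * D ^+ 3 * tau * d * rnorm x) * (h + tau * d) by ring.
have -> : K * d * (h + d) * rnorm x =
  (L * D ^+ 3 * tau * d * rnorm x) * ((1 + tau) * (h + d)) by rewrite /K; ring.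
apply: ler_wpM2l; first by rewrite !mulr_ge0 ?exprn_ge0.
rewrite mulrDl mul1r mulrDr -!addrA lerD2l addrA lerDr.
by rewrite addr_ge0 ?mulr_ge0.
Qed.

(** The segment from [0] to [r] is cut into [M + 1] equal steps. The quadratic errors in the step
    length add up to [O(1 / M)], and only the part in [h] survives. *)
Lemma homotopy x : rnorm (I r x - I 0 x) <= K * h * rnorm x.
Proof.
have /andP[r0 r1] := r01.
apply: (@ler_addr_invn _ _ _ (K * rnorm x)) => M.
pose s (i : nat) := r * (i%:R / M.+1%:R).
have M0 : 0 < M.+1%:R :> R by rewrite ltr0n.
have hs i : (i <= M.+1)%N -> 0 <= s i <= r.
  move=> iM; rewrite /s mulr_ge0 ?divr_ge0 //=.
  by rewrite ler_piMr // ler_pdivrMr // mul1r ler_nat.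
have ds i : s i.+1 - s i = r / M.+1%:R.
  by rewrite /s -natr1; field; rewrite nat1r gt_eqF.
have key i : (i <= M.+1)%N -> rnorm (I (s i) x - I (s 0%N) x)
    <= i%:R * (K * (r / M.+1%:R) * (h + r / M.+1%:R) * rnorm x).
  elim: i => [|i IH] iM; first by rewrite subrr rnorm0 mul0r.
  rewrite -(subrK (I (s i) x) (I (s i.+1) x)) -addrA.
  apply: le_trans (ler_rnormD _ _) _.
  rewrite -[i.+1%:R]natr1 mulrDl mul1r [X in X <= _]addrC.
  apply: lerD; first exact: IH (ltnW iM).
  have dp : 0 <= r / M.+1%:R by rewrite divr_ge0.
  have := homotopy_step x (hs _ iM) (hs _ (ltnW iM)).
  by rewrite ds ger0_norm.
have := key _ (leqnn _).
have -> : s M.+1 = r by rewrite /s divff ?mulr1 // gt_eqF.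
have -> : s 0%N = 0 by rewrite /s mul0r mulr0.
move=> /le_trans; apply.
have Kx : 0 <= K * rnorm x by rewrite mulr_ge0 ?rnorm_ge0.
have -> : M.+1%:R * (K * (r / M.+1%:R) * (h + r / M.+1%:R) * rnorm x) =
  (K * rnorm x) * (r * h + r * r / M.+1%:R).
  by move: (M.+1%:R : R) M0 => m m0; field; rewrite gt_eqF.
have -> : K * h * rnorm x + K * rnorm x / M.+1%:R =
  (K * rnorm x) * (h + M.+1%:R^-1) by ring.
apply: ler_wpM2l => //; apply: lerD; first by rewrite ler_piMl.
by rewrite ler_piMl ?invr_ge0 // mulr_ile1.
Qed.

(** A Riemann sum of [dl / l]. It is kept as a factor instead of being compared with [2 i pi], so
    that a lower bound of its modulus suffices. *)
Let winding := \sum_(j < N) (l j.+1 - l j) / l j.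

Lemma I0E x : I 0 x = winding *: x.
Proof.
have /andP[r0 _] := r01.
have h0r : 0 <= (0 : R) <= r by rewrite lexx r0.
rewrite /I /winding scaler_suml; apply: eq_bigr => j _.
by rewrite (resolvent_uniq (resP j h0r) (is_resolvent_zero T (l_neq0 j))) scalerA.
Qed.

(** [l ^ a] has a primitive, whose increments sum to zero on a closed contour; [E] is the
    second-order Taylor remainder. *)
Lemma step_moment a : rnorm (\sum_(j < N) (l j.+1 - l j) * l j ^+ a)
  <= a.+1%:R * L * h.
Proof.
pose E n (z w : R[i]) := w ^+ n.+1 - z ^+ n.+1 - n.+1%:R * z ^+ n * (w - z).
have EE n z w : E n.+1 z w = w * E n z w + n.+1%:R * z ^+ n * (w - z) ^+ 2.
  by rewrite /E !exprS -[n.+2%:R]natr1; ring.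
have Eb n j : rnorm (E n (l j) (l j.+1)) <= n.+1%:R ^+ 2 * h ^+ 2.
  elim: n => [|n IH].
    have -> : E 0%N (l j) (l j.+1) = 0 by rewrite /E; ring.
    by rewrite rnorm0 mulr_ge0 ?exprn_ge0.
  rewrite EE; apply: le_trans (ler_rnormD _ _) _.
  apply: le_trans (_ : n.+1%:R ^+ 2 * h ^+ 2 + n.+1%:R * h ^+ 2 <= _).
    apply: lerD.
      rewrite rnormM; apply: le_trans IH.
      by rewrite ler_piMl ?rnorm_ge0.
    rewrite !rnormM rnorm_nat !rnormX; apply: ler_pM => //.
    - by rewrite mulr_ge0 ?exprn_ge0 ?rnorm_ge0.
    - by rewrite mulr_ge0 ?rnorm_ge0.
    - by rewrite ler_piMr // exprn_ile1 ?rnorm_ge0.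
    - by rewrite expr2 ler_pM ?rnorm_ge0.
  rewrite -mulrDl ler_wpM2r ?exprn_ge0 // -[n.+2%:R]natr1.
  have : 0 <= n.+1%:R :> R by []. nra.
have a0 : 0 < a.+1%:R :> R by rewrite ltr0n.
have tel : a.+1%:R * (\sum_(j < N) (l j.+1 - l j) * l j ^+ a) =
  - \sum_(j < N) E a (l j) (l j.+1).
  have : \sum_(j < N) (l j.+1 ^+ a.+1 - l j ^+ a.+1) = 0.
    by rewrite -(big_mkord xpredT (fun j => l j.+1 ^+ a.+1 - l j ^+ a.+1))
      telescope_sumr // closed_l subrr.
  move=> t0; rewrite -[LHS]subr0 -[X in _ - X = _]t0 mulr_sumr -sumrB -sumrN.
  by apply: eq_bigr => j _; rewrite /E; ring.
rewrite -(ler_pM2l a0) -[X in X * rnorm _](rnorm_nat R) -rnormM tel rnormN.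
apply: le_trans (ler_rnorm_sum _ _ _) _.
apply: le_trans (_ : \sum_(j < N) a.+1%:R ^+ 2 * h ^+ 2 <= _).
  by apply: ler_sum => j _; apply: Eb.
rewrite sumr_const card_ord -[X in X <= _]mulr_natl.
have -> : N%:R * (a.+1%:R ^+ 2 * h ^+ 2) = (N%:R * h) * (a.+1%:R ^+ 2 * h).
  by ring.
have -> : a.+1%:R * (a.+1%:R * L * h) = L * (a.+1%:R ^+ 2 * h) by ring.
by apply: ler_wpM2r; rewrite ?mulr_ge0 ?exprn_ge0.
Qed.

(** Error constants of the recursion on the degree. They do not involve the mesh [h], so the error
    for a fixed polynomial is [O(h)]. *)
Fixpoint moment_const (a : nat) : R :=
  if a is b.+1 then b.+1%:R * L + tau * moment_const b else K.

(** [l R(l, r T) = 1 + r T R(l, r T)] lowers the exponent by one and leaves a moment of the contour,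
    which is [O(h)]. *)
Lemma Riemann_sum_monomial a x :
  rnorm (\sum_(j < N) ((l j.+1 - l j) * l j ^+ a) *: res r (l j) x
         - winding *: iter a (scaled r) x) <= moment_const a * h * rnorm x.
Proof.
have /andP[r0 r1] := r01.
have hr : 0 <= r <= r by rewrite r0 lexx.
elim: a => [|a IH].
  rewrite /= -I0E /I; under eq_bigr do rewrite expr0 mulr1.
  exact: homotopy.
pose J := \sum_(j < N) ((l j.+1 - l j) * l j ^+ a) *: res r (l j) x.
have -> : \sum_(j < N) ((l j.+1 - l j) * l j ^+ a.+1) *: res r (l j) x =
    (\sum_(j < N) (l j.+1 - l j) * l j ^+ a) *: x + r%:C *: T J.
  rewrite scaler_suml /J (linear_map_sum _ _ _ T_lin) scaler_sumr -big_split.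
  apply: eq_bigr => j _ /=; have [_ _ /(_ x) KU] := resP j hr.
  rewrite (linear_mapZ _ _ T_lin) scalerA [r%:C * _]mulrC -[_ *: T _]scalerA.
  rewrite -scalerDr; have -> : x + r%:C *: T (res r (l j) x) = l j *: res r (l j) x.
    by apply/eqP; rewrite eq_sym -subr_eq KU.
  by rewrite scalerA exprSr mulrA.
rewrite iterS -addrA.
have -> : r%:C *: T J - winding *: (r%:C *: T (iter a (scaled r) x)) =
    r%:C *: T (J - winding *: iter a (scaled r) x).
  rewrite (linear_mapB _ _ T_lin) (linear_mapZ _ _ T_lin) scalerBr.
  by rewrite !scalerA [winding * _]mulrC.
apply: le_trans (ler_rnormD _ _) _.
rewrite /= !mulrDl; apply: lerD.
  by rewrite rnormZ ler_wpM2r ?rnorm_ge0 ?step_moment.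
rewrite rnormZ rnorm_real ger0_norm //.
apply: le_trans (_ : 1 * (tau * (moment_const a * h * rnorm x)) <= _).
  apply: ler_pM => //; first exact: rnorm_ge0.
  by apply: le_trans (T_bound _) _; apply: ler_wpM2l.
by rewrite mul1r !mulrA.
Qed.

Lemma Riemann_sum_poly Q x :
  rnorm (\sum_(j < N) ((l j.+1 - l j) * Q.[l j]) *: res r (l j) x
         - winding *: poly_op Q (scaled r) x)
  <= (\sum_(a < size Q) rnorm Q`_a * moment_const a) * h * rnorm x.
Proof.
have -> : \sum_(j < N) ((l j.+1 - l j) * Q.[l j]) *: res r (l j) x =
    \sum_(a < size Q) Q`_a *:
      \sum_(j < N) ((l j.+1 - l j) * l j ^+ a) *: res r (l j) x.
  transitivity (\sum_(j < N) \sum_(a < size Q)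
      (Q`_a * ((l j.+1 - l j) * l j ^+ a)) *: res r (l j) x).
    apply: eq_bigr => j _; rewrite horner_coef mulr_sumr scaler_suml.
    by apply: eq_bigr => a _; rewrite mulrCA.
  rewrite exchange_big; apply: eq_bigr => a _ /=.
  by rewrite scaler_sumr; apply: eq_bigr => j _; rewrite scalerA.
rewrite /poly_op scaler_sumr -sumrB !mulr_suml.
apply: le_trans (ler_rnorm_sum _ _ _) _; apply: ler_sum => a _.
rewrite scalerA [winding * _]mulrC -scalerA -scalerBr rnormZ -!mulrA.
rewrite ler_wpM2l ?rnorm_ge0 // mulrA.
exact: Riemann_sum_monomial.
Qed.

End RiemannSums.

(** * The contour and the Stolz domain *)

Section Trigonometry.
Variable R : realType.
Implicit Types (x t s r : R).

Lemma sin_mvt x : 0 < x -> exists2 c, 0 < c < x & sin x = cos c * x.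
Proof.
move=> x0.
have [|c] := @MVT R sin cos 0 x x0 (fun y _ => is_derive_sin y).
  by apply: continuous_subspaceT => y; exact: continuous_sin.
by rewrite in_itv /= sin0 !subr0 => c0x e; exists c.
Qed.

Lemma normr_sin_le x : 0 <= x -> `|sin x| <= x.
Proof.
rewrite le_eqVlt => /orP[/eqP <-|x0]; first by rewrite sin0 normr0.
have [c _ ->] := sin_mvt x0.
by rewrite normrM (gtr0_norm x0) ler_piMl ?cos_max // ltW.
Qed.

Lemma cos_half t : 1 - cos t = 2 * sin (t / 2) ^+ 2.
Proof.
have := cos_mulr2n (t / 2); rewrite -[t / 2 *+ 2]mulr_natr divfK // => ->.
by rewrite cos2sin2 -mulr_natr; ring.
Qed.

Lemma cos_ge t : 1 - t ^+ 2 / 2 <= cos t.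
Proof.
wlog t0 : t / 0 <= t.
  move=> h; have [/h //|/ltW t0] := leP 0 t.
  by rewrite -cosN -sqrrN; apply: h; rewrite oppr_ge0.
have h : `|sin (t / 2)| <= t / 2 by apply: normr_sin_le; rewrite divr_ge0.
have := cos_half t; rewrite -(real_normK (num_real (sin _))) => e.
have : `|sin (t / 2)| ^+ 2 <= (t / 2) ^+ 2 by rewrite lerXn2r ?nnegrE // divr_ge0.
lra.
Qed.

(** The mean value theorem gives [x / 2] on [[0, 1]]; beyond [1], monotonicity gives [1 / 2], which
    is enough since [pi / 2 < 2]. *)
Lemma sin_ge x : 0 <= x <= pi / 2 -> x / 4 <= sin x.
Proof.
move=> /andP[x0 xpi].
have half (y : R) : 0 <= y <= 1 -> y / 2 <= sin y.
  move=> /andP[]; rewrite le_eqVlt => /orP[/eqP <- _|y0 y1].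
    by rewrite sin0 mul0r.
  have [c /andP[c0 cy] ->] := sin_mvt y0; rewrite mulrC ler_wpM2r ?(ltW y0) //.
  have := cos_ge c; have : c ^+ 2 <= 1 by rewrite expr_le1 // ?ltW //; lra.
  lra.
have [x1|x1] := leP x 1; first by have := half x; rewrite x0 x1 => /(_ isT); lra.
have pi1 := @pihalf_ge1 R; have pi2 := @pihalf_lt2 R.
have : sin 1 < sin x by rewrite ltr_sin // in_itv /=; apply/andP; split; lra.
have : 1 / 2 <= sin (1 : R) by apply: half; rewrite ler01 lexx.
lra.
Qed.

Lemma one_minus_cos_ge t : `|t| <= pi -> t ^+ 2 / 32 <= 1 - cos t.
Proof.
move=> ht; have -> : cos t = cos `|t| by rewrite cos_norm.
rewrite -(real_normK (num_real t)); move: `|t| (normr_ge0 t) ht => u u0 hu.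
have h : u / 2 / 4 <= sin (u / 2).
  by apply: sin_ge; rewrite divr_ge0 //= ler_pM2r.
rewrite cos_half.
have : (u / 2 / 4) ^+ 2 <= sin (u / 2) ^+ 2.
  by rewrite lerXn2r ?nnegrE ?divr_ge0 //; apply: le_trans h; rewrite !divr_ge0.
have -> : (u / 2 / 4) ^+ 2 = u ^+ 2 / 64 by field.
lra.
Qed.

Definition cis t : R[i] := (cos t +i* sin t)%C.

Lemma cisD s t : cis (s + t) = cis s * cis t.
Proof.
rewrite /cis sinD cosD; apply/eqP; rewrite eq_complex /= eqxx /=.
by rewrite addrC.
Qed.

Lemma rnorm_cis t : rnorm (cis t) = 1.
Proof.
apply/eqP; rewrite -(eqrXn2 (n := 2)) ?rnorm_ge0 //.
by rewrite rnorm_sqr /= cos2Dsin2 expr1n.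
Qed.

Lemma rnorm_polar_sub r s t :
  rnorm (r%:C * cis t - s%:C) ^+ 2 = (r - s) ^+ 2 + 2 * r * s * (1 - cos t).
Proof.
rewrite rnorm_sqr /= !mul0r !subr0 addr0.
have -> : (r * cos t - s) ^+ 2 + (r * sin t) ^+ 2 =
  r ^+ 2 * (cos t ^+ 2 + sin t ^+ 2) + s ^+ 2 - 2 * r * s * cos t by ring.
by rewrite cos2Dsin2; ring.
Qed.

Lemma rnorm_cis_sub s t : rnorm (cis t - cis s) <= `|t - s|.
Proof.
have -> : cis t - cis s = cis s * (1%:C * cis (t - s) - 1%:C).
  by rewrite mulrBr mul1r -cisD mulr1 [s + _]addrC subrK.
rewrite rnormM rnorm_cis mul1r -(ler_pXn2r (n := 2)) ?nnegrE ?rnorm_ge0 //.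
rewrite rnorm_polar_sub real_normK ?num_real //.
have := cos_ge (t - s); lra.
Qed.

End Trigonometry.

(** * Geometry of the contour *)

Section Curve.
Variables (R : realType) (k : R).
Hypotheses (k_gt0 : 0 < k) (k_le : k <= 16^-1).
Implicit Types (t s r : R).

(* On [-pi, pi]: a closed curve with a corner at [1], close enough to the unit
   circle for the resolvent estimate to hold on and outside it. *)
Definition curve t : R[i] := (1 - k * `|t|)%:C * cis t.

Lemma pi_lt4 : pi < 4 :> R.
Proof. by have := @pihalf_lt2 R; lra. Qed.

Lemma radius_ge t : `|t| <= pi -> 3 / 4 <= 1 - k * `|t|.
Proof.
move=> ht; have t4 : `|t| <= 4 by apply: le_trans ht (ltW pi_lt4).
have := ler_pM (ltW k_gt0) (normr_ge0 t) k_le t4; lra.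
Qed.

Lemma rnorm_curve t : `|t| <= pi -> rnorm (curve t) = 1 - k * `|t|.
Proof.
move=> /radius_ge ht; rewrite rnormM rnorm_cis mulr1 rnorm_real ger0_norm //.
lra.
Qed.

Lemma rnorm_curve_le1 t : `|t| <= pi -> rnorm (curve t) <= 1.
Proof. by move=> ht; rewrite rnorm_curve // gerBl mulr_ge0 // ltW. Qed.

Lemma curve_neq0 t : `|t| <= pi -> curve t != 0.
Proof.
by move=> ht; rewrite -rnorm_gt0 rnorm_curve //; have := radius_ge ht; lra.
Qed.

Lemma curve_Lipschitz s t : `|s| <= pi -> rnorm (curve t - curve s) <= 2 * `|t - s|.
Proof.
move=> hs.
have -> : curve t - curve s =
    (k * (`|s| - `|t|))%:C * cis t + (1 - k * `|s|)%:C * (cis t - cis s).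
  by rewrite /curve !rmorphB !rmorphM /= rmorphB /=; ring.
apply: le_trans (ler_rnormD _ _) _; rewrite !rnormM rnorm_cis mulr1 !rnorm_real.
have h1 : `|k * (`|s| - `|t|)| <= 1 * `|t - s|.
  rewrite normrM distrC gtr0_norm //; apply: ler_pM => //; first exact: ltW.
    by move: k_le; lra.
  exact: ler_dist_dist.
have h2 : `|1 - k * `|s| | * rnorm (cis t - cis s) <= 1 * `|t - s|.
  apply: ler_pM => //; first exact: rnorm_ge0; last exact: rnorm_cis_sub.
  rewrite ger0_norm; last by have := radius_ge hs; lra.
  by rewrite gerBl mulr_ge0 // ltW.
lra.
Qed.

Lemma curve0 : curve 0 = 1.
Proof.
rewrite /curve normr0 mulr0 subr0 mul1r /cis cos0 sin0.
by apply/eqP; rewrite eq_complex /= !eqxx.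
Qed.

Lemma rnorm_curve_sub1 t : rnorm (curve t - 1) <= 2 * `|t|.
Proof.
rewrite -curve0 -{2}[t]subr0; apply: curve_Lipschitz.
by rewrite normr0 pi_ge0.
Qed.

Lemma curve_pi : curve (- pi) = curve pi.
Proof.
rewrite /curve normrN /cis cosN sinN sinpi oppr0; by [].
Qed.

(** In the squared distance [(q - r)^2 + 2 q r (1 - cos t)] the angular term is enough by itself. *)
Lemma curve_sub_ge t r : `|t| <= pi -> 2^-1 <= r -> `|t| / 8 <= rnorm (curve t - r%:C).
Proof.
move=> ht hr; have := radius_ge ht; set q := 1 - k * `|t| => hq.
rewrite -(ler_pXn2r (n := 2)) ?nnegrE ?rnorm_ge0 ?divr_ge0 //.
rewrite rnorm_polar_sub -/q.
have := one_minus_cos_ge ht; rewrite -(real_normK (num_real t)).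
have : 3 / 4 * 2^-1 <= q * r by apply: ler_pM.
have := sqr_ge0 (q - r); have : 0 <= 1 - cos t by rewrite subr_ge0 cos_le1.
move: (`|t|) (cos t) ((q - r) ^+ 2) => u v w.
move=> v0 w0 qr uv.
have : (3 / 4 * 2^-1) * (1 - v) <= (q * r) * (1 - v) by apply: ler_wpM2r.
have -> : (u / 8) ^+ 2 = u ^+ 2 / 64 by field.
lra.
Qed.

(** A gap uniform in [t]: it is radial when [r] or [|t|] is small, and angular otherwise. *)
Lemma curve_sub_gt t r (r1 : R) : `|t| <= pi -> 0 <= r <= r1 -> r1 < 1 ->
  (1 - r1) / 8 <= rnorm (curve t - r%:C).
Proof.
move=> ht /andP[r0 rr1] r11; have hq := radius_ge ht.
have h : 1 - k * `|t| - r <= rnorm (curve t - r%:C).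
  rewrite -(rnorm_curve ht); have := ler_rnorm_dist (curve t) r%:C.
  by rewrite rnorm_real (ger0_norm r0); lra.
have [hr|hr] := leP r 2^-1; first by apply: le_trans h; lra.
have h2 := curve_sub_ge ht (ltW hr).
have [ht2|ht2] := leP (1 - r1) `|t|; first by apply: le_trans h2; lra.
apply: le_trans h.
have : k * `|t| <= 16^-1 * `|t| by apply: ler_wpM2r.
lra.
Qed.

(** The curve enters the disc by [k |t|], while its distance to [r] is at least [|t| / 8]; this
    fixes the slope [k = c / 8] used later. For [r <= 1/2] the left side is negative. *)
Lemma curve_region c t r : k <= c / 8 -> `|t| <= pi -> 0 <= r <= 1 ->
  r - rnorm (curve t) <= c * rnorm (curve t - r%:C).
Proof.
move=> kc ht /andP[r0 r1]; rewrite rnorm_curve //; have hq := radius_ge ht.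
have c0 : 0 < c by move: k_gt0; lra.
have [hr|/ltW hr] := leP r 2^-1.
  by apply: le_trans (_ : 0 <= _); [lra | rewrite mulr_ge0 ?rnorm_ge0 // ltW].
have := ler_wpM2l (ltW c0) (curve_sub_ge ht hr).
have : k * `|t| <= (c / 8) * `|t| by apply: ler_wpM2r.
lra.
Qed.

(** The ratio of the two points is a real number, at least [3/4], times [cis h], and
    [sin h >= h / 4]. *)
Lemma Im_curve_ratio t h : `|t| <= pi -> `|t + h| <= pi -> 0 <= h <= pi / 2 ->
  3 / 16 * h <= complex.Im ((curve (t + h) - curve t) / curve t).
Proof.
move=> ht hth hh; have /andP[h0 _] := hh.
pose q s := 1 - k * `|s|.
have qt := radius_ge ht; have qth := radius_ge hth.
have qt0 : 0 < q t by rewrite /q; lra.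
have -> : (curve (t + h) - curve t) / curve t = (q (t + h) / q t)%:C * cis h - 1%:C.
  have c0 := curve_neq0 ht.
  apply: (mulIf c0); rewrite divfK // mulrBl mul1r; congr (_ - _).
  rewrite /curve -/(q t) -/(q (t + h)) cisD [cis t * cis h]mulrC mulrA.
  rewrite -[in LHS](divfK (lt0r_neq0 qt0) (q (t + h))) rmorphM /=; ring.
rewrite /= !mul0r addr0 subr0.
have sh := sin_ge hh.
have qq : 3 / 4 <= q (t + h) / q t.
  rewrite ler_pdivlMr //; apply: le_trans (_ : 3 / 4 * 1 <= _).
    by rewrite ler_pM2l // /q gerBl mulr_ge0 // ltW.
  by rewrite mulr1.
have := ler_pM _ _ qq sh; rewrite !divr_ge0 // => /(_ isT isT).
by lra.
Qed.

Lemma rnorm_curve_polar_sub t s :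
  rnorm (curve t - s%:C) ^+ 2 =
  (1 - k * `|t| - s) ^+ 2 + 2 * (1 - k * `|t|) * s * (1 - cos t).
Proof. exact: rnorm_polar_sub. Qed.

(* For small [t] the curve point is compared with the convex combination of
   [1] and a disc point of weight [(1 + k^2) / k * |t|]. *)
Lemma curve_in_Stolz (g : R) t : 0 <= sin g -> cos g = k / 2 ->
  0 < `|t| <= pi -> Stolz_domain g (curve t).
Proof.
move=> sg cg /andP[t0 ht].
have sg2 : sin g ^+ 2 = 1 - k ^+ 2 / 4 by rewrite sin2cos2 cg; field.
(* The disc of centre [s] and radius [(1 - s) sin g] lies in the hull: it is the image of the disc
   around [0] under [w -> s + (1 - s) w]. *)
have [s [/andP[s0 s1] hs]] : exists s : R,
    0 <= s < 1 /\ rnorm (curve t - s%:C) < (1 - s) * sin g.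
  pose A := (1 + k ^+ 2) / k.
  have qt := radius_ge ht.
  have k2 : 0 < k ^+ 2 by rewrite exprn_gt0.
  have k21 : k ^+ 2 <= 1 by rewrite expr_le1 ?ltW //; move: k_le; lra.
  have A0 : 0 < A by rewrite divr_gt0 // addr_gt0.
  have Ak : A * k = 1 + k ^+ 2 by rewrite divfK // gt_eqF.
  have [At|At] := ltP (A * `|t|) 1.
    have At0 : 0 < A * `|t| by rewrite mulr_gt0.
    exists (1 - A * `|t|); split; first by apply/andP; split; lra.
    have As : 0 <= A * `|t| * sin g by apply: mulr_ge0 sg; exact: ltW.
    rewrite subKr -(ltr_pXn2r (n := 2)) ?nnegrE ?rnorm_ge0 //.
    rewrite rnorm_curve_polar_sub exprMn sg2.
    have -> : 1 - k * `|t| - (1 - A * `|t|) = `|t| / k.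
      by rewrite /A; field; rewrite gt_eqF.
    have c2 : 1 - cos t <= `|t| ^+ 2 / 2.
      by rewrite real_normK ?num_real //; have := cos_ge t; lra.
    have c0 : 0 <= 1 - cos t by rewrite subr_ge0 cos_le1.
    apply: le_lt_trans (_ : (`|t| / k) ^+ 2 + 2 * 1 * 1 * (`|t| ^+ 2 / 2) < _).
      rewrite lerD2l; apply: ler_pM => //.
        by rewrite !mulr_ge0 //; lra.
      apply: ler_pM => //; [by rewrite mulr_ge0 //; lra | by lra | | by lra].
      apply: ler_pM => //; first by lra.
      by rewrite gerBl mulr_ge0 // ltW.
    have -> : (`|t| / k) ^+ 2 + 2 * 1 * 1 * (`|t| ^+ 2 / 2) =
        (`|t| / k) ^+ 2 * (1 + k ^+ 2) by field; rewrite gt_eqF.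
    have -> : (A * `|t|) ^+ 2 * (1 - k ^+ 2 / 4) =
        (`|t| / k) ^+ 2 * ((1 + k ^+ 2) ^+ 2 * (1 - k ^+ 2 / 4)).
      by rewrite /A; field; rewrite gt_eqF.
    (* There remains [1 + z < (1 + z)^2 (1 - z / 4)] for [z = k^2] in [(0, 1]]; the last factor is
       [sin g ^ 2], which is where [cos g = k / 2] enters. *)
    rewrite ltr_pM2l ?exprn_gt0 ?divr_gt0 //.
    move: (k ^+ 2) k2 k21 => z z0 z1; nra.
  (* Away from the corner the curve already lies in the disc around [0]. *)
  exists 0; split; first by rewrite lexx ltr01.
  rewrite !subr0 mul1r rnorm_curve //.
  have kt : k ^+ 2 <= (1 + k ^+ 2) * (k * `|t|).
    have -> : (1 + k ^+ 2) * (k * `|t|) = k ^+ 2 * (A * `|t|).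
      by rewrite -Ak; ring.
    by rewrite ler_peMr // ltW.
  rewrite -(ltr_pXn2r (n := 2)) ?nnegrE //; last by lra.
  rewrite sg2.
  have : 0 < k * `|t| by rewrite mulr_gt0.
  move: (k * `|t|) kt qt => u; move: (k ^+ 2) k2 k21 => z; nra.
(* The slack [e] puts a whole ball around the point into the same disc, hence the point into the
   interior. *)
pose e := (1 - s) * sin g - rnorm (curve t - s%:C).
have e0 : 0 < e by rewrite subr_gt0.
apply/nbhs_ballP; exists e%:C; first by rewrite /= ltcR.
move=> z; rewrite -ball_normE /= -rnormE ltcR => hz.
have hz2 : rnorm (z - s%:C) < (1 - s) * sin g.
  have -> : z - s%:C = (z - curve t) + (curve t - s%:C) by rewrite addrA subrK.
  apply: le_lt_trans (ler_rnormD _ _) _; move: hz; rewrite rnormBC /e; lra.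
move=> M [Mc MG].
have s1' : 0 < 1 - s by rewrite subr_gt0.
have s1C : (1 - s)%:C != 0 :> R[i].
  by rewrite (fmorph_eq0 (@real_complex R)) gt_eqF.
pose w : R[i] := (z - s%:C) / (1 - s)%:C.
have Mw : M w.
  apply: MG; right; change (ball (0 : R[i]^o) (sin g)%:C w).
  rewrite -ball_normE /= sub0r normrN -rnormE ltcR.
  by rewrite /w rnormM rnormV rnorm_real gtr0_norm // ltr_pdivrMr // mulrC.
have M1 : M 1 by apply: MG; left.
have sC0 : 0 <= s%:C :> R[i] by rewrite ler0c.
have sC1 : s%:C <= 1 :> R[i] by rewrite -[1]/(1%:C) lecR ltW.
have := Mc (1 : R[i]^o) (w : R[i]^o) (Itv01 sC0 sC1).
rewrite !in_setE => /(_ M1 Mw).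
suff -> : z = s%:C * 1 + (1 - s%:C) * w by [].
rewrite mulr1 -[X in X - s%:C]/(1%:C) -rmorphB /w mulrC divfK //.
by rewrite addrC subrK.
Qed.

End Curve.

(** * R-bounded polynomial calculus along the contour *)

Section ContourCalculus.
Variables (R : realType) (X : completeNormedModType R[i]).

(* A lower Riemann sum of [(n + 1) (1 - u) ^ n] over [0, 1]. *)
Lemma sum_geometric_le (n p : nat) (d : R) : 0 <= d -> p%:R * d <= 1 ->
  \sum_(i < p) n.+1%:R * d * (1 - d * i.+1%:R) ^+ n <= 1.
Proof.
move=> d0 pd; pose v (i : nat) := 1 - d * i%:R.
have v0 (i : nat) : (i <= p)%N -> 0 <= v i.
  move=> ip; rewrite subr_ge0 mulrC; apply: le_trans pd.
  by rewrite ler_wpM2r // ler_nat.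
have dv i : v i - v i.+1 = d by rewrite /v -natr1; ring.
(* Factoring the difference of powers gives [d] times [n + 1] terms, each at least [v i.+1 ^+ n]. *)
have step i : (i < p)%N -> n.+1%:R * d * v i.+1 ^+ n <= v i ^+ n.+1 - v i.+1 ^+ n.+1.
  move=> ip; rewrite subrXX dv mulrAC mulrC ler_wpM2l //.
  have -> : n.+1%:R * v i.+1 ^+ n = \sum_(j < n.+1) v i.+1 ^+ n.
    by rewrite sumr_const card_ord mulr_natl.
  apply: ler_sum => j _; have jn : (j <= n)%N by rewrite -ltnS.
  rewrite /= -{1}(subnK jn) exprD; apply: ler_wpM2r; first exact/exprn_ge0/v0.
  rewrite lerXn2r ?nnegrE ?v0 //; first exact: ltnW.
  by rewrite -subr_ge0 dv.
apply: le_trans (_ : \sum_(i < p) (v i ^+ n.+1 - v i.+1 ^+ n.+1) <= _).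
  by apply: ler_sum => i _; apply: step.
have -> : \sum_(i < p) (v i ^+ n.+1 - v i.+1 ^+ n.+1) = v 0%N ^+ n.+1 - v p ^+ n.+1.
  rewrite -[LHS]opprK -sumrN; under eq_bigr do rewrite opprB.
  rewrite -(big_mkord xpredT (fun i => v i.+1 ^+ n.+1 - v i ^+ n.+1)).
  by rewrite telescope_sumr // opprB.
by rewrite /v mulr0 subr0 expr1n gerBl exprn_ge0 // v0.
Qed.

Variables (T : X -> X) (T_lin : linear T).
Local Notation scaled r := (fun x : X => r%:C *: T x).
Local Notation res r l := (resolvent (scaled r) l).

Lemma iter_scaled r a x : iter a (scaled r) x = (r ^+ a)%:C *: iter a T x.
Proof.
elim: a => [|a IH]; first by rewrite expr0 scale1r.
by rewrite !iterS IH (linear_mapZ _ _ T_lin) scalerA -rmorphM exprS.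
Qed.

Lemma poly_op_scaled_dist Q x (r : R) : 0 <= r <= 1 ->
  rnorm (poly_op Q T x - poly_op Q (scaled r) x) <=
  (1 - r) * \sum_(a < size Q) a%:R * rnorm (Q`_a *: iter a T x).
Proof.
move=> /andP[r0 r1]; rewrite /poly_op -sumrB mulr_sumr.
apply: le_trans (ler_rnorm_sum _ _ _) _; apply: ler_sum => a _.
rewrite iter_scaled scalerA mulrC -scalerA -[X in rnorm (X - _)]scale1r -scalerBl.
rewrite rnormZ mulrA ler_wpM2r ?rnorm_ge0 //.
rewrite -(rmorph1 (@real_complex R)) -rmorphB rnorm_real ger0_norm; last first.
  by rewrite subr_ge0 exprn_ile1.
elim: (a : nat) => [|b IH]; first by rewrite expr0 subrr mulr0.
rewrite exprS -natr1.
have : 1 - r * r ^+ b = (1 - r) + r * (1 - r ^+ b) by ring.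
move=> ->; rewrite [X in _ <= X]mulrDr mulr1 [X in _ <= X]addrC lerD2l.
by apply: le_trans IH; rewrite ler_piMl // subr_ge0 exprn_ile1.
Qed.

Variables (tau C0 : R).
Hypotheses (T_bound : forall x, rnorm (T x) <= tau * rnorm x) (tau0 : 0 <= tau).
Hypotheses (specT : spectrum T `<=` [set l | rnorm l <= 1]) (C01 : 1 <= C0).
Hypothesis Ritt_R_bound : forall n (S : 'I_n -> X -> X) (x : 'I_n -> X),
  (forall j, Ritt_set T (S j)) ->
  Rademacher_mean (fun j => S j (x j)) <= C0 * Rademacher_mean x.

Let c := (16 * C0)^-1.
Let k := c / 8.

Let C0_gt0 : 0 < C0. Proof. exact: lt_le_trans C01. Qed.

Let k_gt0 : 0 < k.
Proof. by rewrite divr_gt0 // invr_gt0 mulr_gt0. Qed.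

Let k_le : k <= 16^-1.
Proof.
rewrite /k /c -[leRHS]mulr1 invfM -mulrA; apply: ler_wpM2l => //.
rewrite ler_pdivrMr // mul1r; apply: le_trans (_ : 1 <= _); last by rewrite ler1n.
by rewrite invf_le1.
Qed.

(** The bound degenerates as [r] tends to [1]; it only controls Riemann-sum errors, for which [r] is
    fixed. *)
Lemma curve_resolvent (s r t : R) x : 0 <= s <= r -> r < 1 -> `|t| <= pi ->
  is_resolvent (scaled s) (curve k t) (res s (curve k t)) /\
  rnorm (res s (curve k t) x) <= 64 * C0 / (1 - r) * rnorm x.
Proof.
move=> hs r1 ht; have /andP[s0 sr] := hs; have r1' : 0 < 1 - r by rewrite subr_gt0.
have s1 : 0 <= s <= 1 by rewrite s0 (le_trans sr) // ltW.
have dist := curve_sub_gt k_gt0 k_le ht hs r1.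
have d0 : 0 < rnorm (curve k t - s%:C) by apply: lt_le_trans dist; rewrite divr_gt0.
have x0 := rnorm_ge0 x.
have [s00|sn0] := eqVneq s 0.
  have hU := is_resolvent_zero T (curve_neq0 k_gt0 k_le ht).
  rewrite -s00 in hU; split; first exact: resolventP hU.
  rewrite (resolvent_uniq (resolventP hU) hU) rnormZ; apply: ler_wpM2r => //.
  rewrite rnormV (rnorm_curve k_gt0 k_le ht).
  have hq := radius_ge k_gt0 k_le ht.
  apply: le_trans (_ : 64 * 1 <= _).
    by rewrite invf_ple ?posrE //; lra.
  rewrite -mulrA ler_pM2l // ler_pdivlMr // mul1r.
  by move: C01; lra.
have sgt0 : 0 < s by rewrite lt_def sn0.
have region := curve_region k_gt0 k_le (lexx k) ht s1.
have lr : curve k t != s%:C by rewrite -subr_eq0 -rnorm_gt0.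
have bd S y := @R_bounded_singleton _ _ _ C0 S y Ritt_R_bound.
have [U [hU _]] := region_resolvent T_lin specT C01 erefl bd sgt0 lr region.
split; first exact: resolventP hU.
have := @region_bound _ _ _ T_lin C0 c s _ _ x specT C01 erefl Ritt_R_bound
  sgt0 lr region (resolventP hU).
move: (rnorm (res _ _ _)) (rnorm_ge0 (res s (curve k t) x)) => u u0 h.
rewrite mulrAC ler_pdivlMr //.
have := ler_wpM2r u0 dist; nra.
Qed.

Variables (m : nat) (Q : 'I_m -> {poly R[i]}) (n : 'I_m -> nat) (M : R).
Hypothesis M_gt0 : 0 < M.
Hypothesis Q_le : forall i t, `|t| <= pi ->
  rnorm (Q i).[curve k t] <= M * (n i).+1%:R * `|t| * (1 - k * `|t|) ^+ n i.

Section Grid.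
Variables (p : nat) (r : R).
Hypotheses (p_gt1 : (1 < p)%N) (np : forall i, (n i < p)%N).
Hypotheses (r_ge : 2^-1 <= r) (r_lt1 : r < 1).

Let p0 : 0 < p%:R :> R. Proof. by rewrite ltr0n ltnW. Qed.
Let pi0 : 0 < pi :> R. Proof. exact: pi_gt0. Qed.

(** Steps of [pi / p] from [-pi] to [pi], with the corner at index [p]. Capping the index makes the
    points constant from [p + p] on, so the step bound holds for every [j]. *)
Definition grid_angle (j : nat) : R := pi / p%:R * ((minn j (p + p))%:R - p%:R).
Definition grid j := curve k (grid_angle j).

Lemma grid_angle_le j : `|grid_angle j| <= pi.
Proof.
rewrite normrM ger0_norm ?divr_ge0 ?pi_ge0 //.
rewrite -[leRHS]mulr1 -mulrA ler_pM2l // mulrC ler_pdivrMr // mul1r.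
rewrite ler_norml lerBlDr -natrD ler_nat geq_minr andbT.
by rewrite lerBrDr addrC subrr.
Qed.

Lemma grid_angleS j : (j < p + p)%N -> grid_angle j.+1 = grid_angle j + pi / p%:R.
Proof.
move=> jp; rewrite /grid_angle (minn_idPl jp) (minn_idPl (ltnW jp)) -natr1; ring.
Qed.

Lemma grid_step j : rnorm (grid j.+1 - grid j) <= 2 * (pi / p%:R).
Proof.
have pp : 0 <= pi / p%:R :> R by rewrite divr_ge0 ?pi_ge0.
have [jp|jp] := ltnP j (p + p).
  apply: le_trans (curve_Lipschitz k_gt0 k_le _ (grid_angle_le _)) _.
  by rewrite grid_angleS // addrC addKr ger0_norm.
rewrite /grid /grid_angle (minn_idPr jp) (minn_idPr (leqW jp)) subrr rnorm0.
by rewrite mulr_ge0.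
Qed.

Lemma grid_closed : grid (p + p) = grid 0.
Proof.
rewrite /grid /grid_angle minnn min0n natrD addrK sub0r mulrN divfK ?gt_eqF //.
by rewrite curve_pi.
Qed.

(** The imaginary parts of the [2 p] terms are all at least [3/16 * pi / p], for a total of
    [3 pi / 8]. *)
Lemma winding_ge :
  2^-1 <= rnorm (\sum_(j < p + p) (grid j.+1 - grid j) / grid j).
Proof.
apply: le_trans (ler_Im_rnorm _); apply: le_trans (ler_norm _).
have hh : 0 <= (pi / p%:R : R) <= pi / 2.
  rewrite divr_ge0 ?pi_ge0 //= ler_pM2l // lef_pV2 ?posrE //.
  by rewrite ler_nat.
have -> : complex.Im (\sum_(j < p + p) (grid j.+1 - grid j) / grid j) =
    \sum_(j < p + p) complex.Im ((grid j.+1 - grid j) / grid j).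
  exact: (raddf_sum (@complex.Im R : Rcomplex R -> R)).
apply: le_trans (_ : \sum_(j < p + p) 3 / 16 * (pi / p%:R) <= _).
  rewrite sumr_const card_ord -[X in _ <= X]mulr_natl natrD.
  have -> : (p%:R + p%:R) * (3 / 16 * (pi / p%:R)) = 3 / 8 * pi :> R.
    by field; rewrite gt_eqF.
  have := @pi_ge2 R; lra.
apply: ler_sum => j _; rewrite /grid grid_angleS //.
apply: Im_curve_ratio => //; first exact: grid_angle_le.
by rewrite -grid_angleS // grid_angle_le.
Qed.

(** The factor [|t|] of [Q_le] cancels the distance from [curve] to [r]. What is left are lower
    Riemann sums of [(n + 1) (1 - u) ^ n] on both sides of the corner, so the mass depends neither
    on [p], nor on [r], nor on [n]. *)
Lemma grid_mass i : \sum_(j < p + p)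
   rnorm ((grid j.+1 - grid j) * (Q i).[grid j] / (grid j - r%:C)) <= 48 * M / k.
Proof.
pose d := k * (pi / p%:R).
have d0 : 0 <= d.
  by apply: mulr_ge0; [exact: ltW | rewrite divr_ge0 ?pi_ge0].
have kpi : k * pi <= 1.
  have := ler_pM (ltW k_gt0) (ltW pi0) k_le (ltW (pi_lt4 R)); lra.
have Mk : 0 <= 16 * M / k.
  by apply: divr_ge0; [apply: mulr_ge0 => //; exact: ltW | exact: ltW].
have dp : p%:R * d <= 1.
  have -> : p%:R * d = k * pi by rewrite /d; field; rewrite gt_eqF.
  exact: kpi.
pose F (j : nat) := (n i).+1%:R * d * (1 - k * `|grid_angle j|) ^+ n i.
have hF j : rnorm ((grid j.+1 - grid j) * (Q i).[grid j] / (grid j - r%:C))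
    <= 16 * M / k * F j.
  rewrite !rnormM rnormV.
  have hq := radius_ge k_gt0 k_le (grid_angle_le j).
  have h1 := curve_sub_ge k_gt0 k_le (grid_angle_le j) r_ge.
  have hb : 0 < rnorm (grid j - r%:C).
    have hr : 0 <= r <= r by rewrite lexx (le_trans _ r_ge).
    apply: lt_le_trans (curve_sub_gt k_gt0 k_le (grid_angle_le j) hr r_lt1).
    by rewrite divr_gt0 // subr_gt0.
  rewrite ler_pdivrMr //.
  apply: le_trans (ler_pM _ _ (grid_step j) (Q_le i (grid_angle_le j))) _;
    rewrite ?rnorm_ge0 //.
  set v := 1 - k * `|grid_angle j|.
  have e1 : 2 * (pi / p%:R) * (M * (n i).+1%:R * `|grid_angle j| * v ^+ n i) =
     16 * M / k * F j * (`|grid_angle j| / 8).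
    rewrite /F -/v /d; move: (v ^+ n i) (pi / p%:R) => V P.
    by field; rewrite gt_eqF.
  rewrite e1; apply: ler_wpM2l => //.
  apply: (mulr_ge0 Mk).
  rewrite /F; apply: mulr_ge0; first exact: mulr_ge0.
  by apply: exprn_ge0; apply: le_trans hq; rewrite divr_ge0.
apply: le_trans (_ : \sum_(j < p + p) 16 * M / k * F j <= _).
  by apply: ler_sum => j _; apply: hF.
rewrite -mulr_sumr.
have -> : 48 * M / k = 16 * M / k * 3 by ring.
apply: (ler_wpM2l Mk).
have G := sum_geometric_le (n i) d0 dp.
have Fr (j : nat) : (j <= p)%N -> F (p + j)%N = (n i).+1%:R * d * (1 - d * j%:R) ^+ n i.
  move=> jp; rewrite /F /grid_angle (minn_idPl _) ?leq_add2l //.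
  rewrite natrD addrAC subrr add0r ger0_norm ?mulr_ge0 ?divr_ge0 ?pi_ge0 //.
  by rewrite /d !mulrA.
have Fl (j : nat) : (j <= p)%N -> F (p - j)%N = (n i).+1%:R * d * (1 - d * j%:R) ^+ n i.
  move=> jp; rewrite /F /grid_angle (minn_idPl _); last first.
    by apply: leq_trans (leq_subr _ _) (leq_addr _ _).
  rewrite natrB // addrAC subrr add0r mulrN normrN.
  rewrite ger0_norm ?mulr_ge0 ?divr_ge0 ?pi_ge0 //.
  by rewrite /d !mulrA.
(* The corner term is outside both lower sums; [n i < p] keeps it bounded. *)
have nd : (n i).+1%:R * d <= 1.
  by apply: le_trans dp; rewrite ler_wpM2r // ler_nat.
rewrite big_split_ord /=.
apply: le_trans (_ : 1 + (1 + 1) <= _); last by lra.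
apply: lerD.
  rewrite (reindex_inj rev_ord_inj) /=.
  apply: le_trans G; apply: ler_sum => j _; rewrite Fl //.
have pS : p = p.-1.+1 by rewrite prednK // ltnW.
rewrite -(big_mkord xpredT (fun j => F (p + j)%N)) pS big_nat_recl // -pS.
apply: lerD; first by rewrite Fr // mulr0 subr0 expr1n mulr1.
apply: le_trans G; rewrite -(big_mkord xpredT
  (fun j => (n i).+1%:R * d * (1 - d * j.+1%:R) ^+ n i)) pS big_nat_recr // -pS /=.
rewrite -[X in X <= _]addr0; apply: lerD.
  apply: ler_sum_nat => j /andP[_ jp]; rewrite Fr //.
  by apply: leq_trans jp (leq_pred _).
apply: mulr_ge0; first exact: mulr_ge0.
by apply: exprn_ge0; rewrite subr_ge0 mulrC.
Qed.

(** The winding factor has modulus at least [1/2]. The Riemann sums combine the R-bounded operators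
    [(l - r) R(l, r T)] with the mass of [grid_mass]; the main term is uniform in [r], and the error
    carries the factor [h]. *)
Lemma grid_calculus (x : 'I_m -> X) (h := 2 * (pi / p%:R)) :
  2^-1 * Rademacher_mean (fun i => poly_op (Q i) (scaled r) (x i)) <=
  768 * C0 * M / k * Rademacher_mean x +
  h * \sum_i (\sum_(a < size (Q i)) rnorm (Q i)`_a *
        moment_const tau (64 * C0 / (1 - r)) (4 * pi) a) * rnorm (x i).
Proof.
have r0 : 0 < r by apply: lt_le_trans r_ge; rewrite invr_gt0.
have r01 : 0 <= r <= 1 by rewrite !ltW.
have rr : 0 <= r <= r by rewrite lexx ltW.
have D0 : 0 <= 64 * C0 / (1 - r).
  by rewrite divr_ge0 ?mulr_ge0 ?subr_ge0 // ltW.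
have h0 : 0 <= h by rewrite mulr_ge0 // divr_ge0 ?pi_ge0.
have hL : (p + p)%:R * h <= 4 * pi.
  rewrite natrD /h le_eqVlt; apply/orP; left; apply/eqP.
  by field; rewrite gt_eqF.
pose w := \sum_(j < p + p) (grid j.+1 - grid j) / grid j.
pose RS i := \sum_(j < p + p) ((grid j.+1 - grid j) * (Q i).[grid j]) *:
  res r (grid j) (x i).
have approx i : rnorm (RS i - w *: poly_op (Q i) (scaled r) (x i)) <=
    (\sum_(a < size (Q i)) rnorm (Q i)`_a *
      moment_const tau (64 * C0 / (1 - r)) (4 * pi) a) * h * rnorm (x i).
  apply: Riemann_sum_poly => //.
  - exact: grid_closed.
  - by move=> j; apply: curve_neq0 => //; exact: grid_angle_le.
  - by move=> j; apply: rnorm_curve_le1 => //; exact: grid_angle_le.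
  - exact: grid_step.
  - by move=> s j hs; case: (curve_resolvent 0 hs r_lt1 (grid_angle_le j)).
  - by move=> s j y hs; case: (curve_resolvent y hs r_lt1 (grid_angle_le j)).
have grid_r j : grid j != r%:C.
  rewrite -subr_eq0 -rnorm_gt0.
  apply: lt_le_trans (curve_sub_gt k_gt0 k_le (grid_angle_le j) rr r_lt1).
  by rewrite divr_gt0 // subr_gt0.
have hull : Rademacher_mean RS <= 2 * (48 * M / k) * (8 * C0 * Rademacher_mean x).
  pose N := (p.-1 + p)%N.
  have NE : (p + p)%N = N.+1 by rewrite -addSn prednK // ltnW.
  pose a i (j : 'I_N.+1) :=
    (grid j.+1 - grid j) * (Q i).[grid j] / (grid j - r%:C).
  pose v i (j : 'I_N.+1) := (grid j - r%:C) *: res r (grid j) (x i).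
  rewrite (@eq_Rademacher _ _ _ RS (fun i => \sum_j a i j *: v i j)).
    apply: Rademacher_hull.
    - by rewrite divr_gt0 // mulr_gt0.
    - by move=> i; have := grid_mass i; rewrite NE.
    - move=> f; apply: (@region_R_bounded _ _ _ T_lin C0 c r m
        (fun i => grid (f i)) (fun i => res r (grid (f i))) x) => // j.
        exact: (curve_region k_gt0 k_le (lexx k) (grid_angle_le _) r01).
      by case: (curve_resolvent 0 rr r_lt1 (grid_angle_le (f j))).
  move=> i; rewrite /RS NE; apply: eq_bigr => j _.
  by rewrite scalerA divfK // subr_eq0.
apply: le_trans (_ : rnorm w * Rademacher_mean
    (fun i => poly_op (Q i) (scaled r) (x i)) <= _).
  by apply: ler_wpM2r; [exact: Rademacher_ge0 | exact: winding_ge].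
rewrite -RademacherZ (@eq_Rademacher _ _ _ _ (fun i => RS i +
    (w *: poly_op (Q i) (scaled r) (x i) - RS i))); last first.
  by move=> i; rewrite addrC subrK.
apply: le_trans (RademacherD _ _) _; apply: lerD.
  by apply: le_trans hull _; rewrite le_eqVlt; apply/orP; left; apply/eqP; ring.
apply: le_trans (Rademacher_le_sum _) _; rewrite mulr_sumr; apply: ler_sum => i _.
by rewrite rnormBC mulrA [h * _]mulrC.
Qed.

End Grid.

(** Two limits in this order: the mesh tends to [0] for fixed [r], then [r] tends to [1]. *)
Lemma contour_calculus (x : 'I_m -> X) :
  Rademacher_mean (fun i => poly_op (Q i) T (x i)) <=
  1536 * C0 * M / k * Rademacher_mean x.
Proof.
have scaled_bound r : 2^-1 <= r -> r < 1 ->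
    Rademacher_mean (fun i => poly_op (Q i) (scaled r) (x i)) <=
    1536 * C0 * M / k * Rademacher_mean x.
  move=> r_ge r_lt1.
  set E := \sum_i (\sum_(a < size (Q i)) rnorm (Q i)`_a *
        moment_const tau (64 * C0 / (1 - r)) (4 * pi) a) * rnorm (x i).
  apply: (@ler_addr_invn _ _ _ (16 * `|E|)) => N.
  (* Larger than every [n i], and larger than [N], so that the mesh is [O(1 / N)]. *)
  pose p := (N + \max_i n i).+2.
  have np i : (n i < p)%N.
    by rewrite /p ltnS leqW // (leq_trans (leq_bigmax i)) // leq_addl.
  have := @grid_calculus p r isT np r_ge r_lt1 x; rewrite -/E.
  have hE : 2 * (pi / p%:R) * E <= 8 * `|E| / N.+1%:R.
    apply: le_trans (_ : 2 * (4 / N.+1%:R) * `|E| <= _); last first.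
      by rewrite le_eqVlt; apply/orP; left; apply/eqP; ring.
    have pp : 0 <= pi / p%:R :> R by rewrite divr_ge0 ?pi_ge0.
    apply: le_trans (_ : 2 * (pi / p%:R) * `|E| <= _).
      by apply: ler_wpM2l; [rewrite mulr_ge0 | exact: ler_norm].
    rewrite ler_wpM2r // ler_pM2l // ler_pM ?pi_ge0 ?invr_ge0 //.
      exact: ltW (pi_lt4 R).
    by rewrite lef_pV2 ?posrE ?ltr0n // ler_nat /p ltnS leqW // leq_addr.
  move: (Rademacher_mean _) => u; move: (Rademacher_mean x) => v h.
  have {}h := le_trans h (lerD (lexx _) hE).
  have -> : 1536 * C0 * M / k * v + 16 * `|E| / N.+1%:R =
    2 * (768 * C0 * M / k * v + 8 * `|E| / N.+1%:R) by ring.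
  have -> : u = 2 * (2^-1 * u) by field.
  by rewrite ler_pM2l.
set E := \sum_i \sum_(a < size (Q i)) a%:R * rnorm ((Q i)`_a *: iter a T (x i)).
apply: (@ler_addr_invn _ _ _ E) => N.
have E0 : 0 <= E.
  by do 2!apply: sumr_ge0 => ? _; rewrite mulr_ge0 ?rnorm_ge0.
(* The shift by two gives [r >= 1/2] already at [N = 0]. *)
pose r : R := 1 - N.+2%:R^-1.
have N2 : (2 : R) <= N.+2%:R by rewrite ler_nat.
have N0 : 0 < N.+2%:R^-1 :> R by rewrite invr_gt0 ltr0n.
have N3 : N.+2%:R^-1 <= 2^-1 :> R by rewrite lef_pV2 ?posrE ?ltr0n.
have r_ge : 2^-1 <= r by rewrite /r; move: N.+2%:R^-1 N3 => e; lra.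
have r_lt1 : r < 1 by rewrite gtrBl.
rewrite (@eq_Rademacher _ _ _ _ (fun i => poly_op (Q i) (scaled r) (x i) +
    (poly_op (Q i) T (x i) - poly_op (Q i) (scaled r) (x i)))); last first.
  by move=> i; rewrite addrC subrK.
apply: le_trans (RademacherD _ _) _; apply: lerD; first exact: scaled_bound.
apply: le_trans (Rademacher_le_sum _) _.
apply: le_trans (_ : (1 - r) * E <= _).
  rewrite /E mulr_sumr; apply: ler_sum => i _; apply: poly_op_scaled_dist.
  by rewrite (ltW r_lt1) (le_trans _ r_ge).
rewrite mulrC ler_wpM2l // /r subKr lef_pV2 ?posrE ?ltr0n //.
by rewrite ler_nat.
Qed.

End ContourCalculus.

(** * Dyadic decomposition *)

Section PartitionOfUnity.
Variable A : comNzRingType.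
Implicit Types w z : A.

(* The smoothstep polynomial: it has a triple zero at [0] and takes the value [1]
   to order 3 at [1], which makes [smooth_step w - smooth_step (w ^+ 2)]
   divisible by [(w * (1 - w)) ^+ 3]. *)
Definition smooth_step w := w ^+ 3 * (10 - 15 * w + 6 * w ^+ 2).

(** Of the three factors [w (1 - w)] two go to the differences on either side; the third stays here
    and supplies the decay that the contour calculus asks for. *)
Definition dyadic_quotient w :=
  w * (1 - w) * (10 + 15 * w + 21 * w ^+ 2 + 18 * w ^+ 3 + 6 * w ^+ 4).

Definition smooth_rest w := (1 - w) ^+ 2 * (1 + 3 * w + 6 * w ^+ 2).

Lemma smooth_step_diff w :
  smooth_step w - smooth_step (w ^+ 2) = (w ^+ 2 - w) ^+ 2 * dyadic_quotient w.
Proof. by rewrite /smooth_step /dyadic_quotient; ring. Qed.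

Lemma one_minus_smooth_step w : 1 - smooth_step w = (1 - w) * smooth_rest w.
Proof. by rewrite /smooth_step /smooth_rest; ring. Qed.

(** The differences of [smooth_step] telescope along [w = z ^ (2 ^ j)], since squaring [w] passes to
    the next [j]. *)
Lemma partition_of_unity z (N : nat) :
  1 = (1 - z) * smooth_rest z
      + \sum_(j < N) (z ^+ (2 ^ j.+1) - z ^+ (2 ^ j)) ^+ 2
                     * dyadic_quotient (z ^+ (2 ^ j))
      + smooth_step (z ^+ (2 ^ N)).
Proof.
rewrite -one_minus_smooth_step.
elim: N => [|N IH]; first by rewrite big_ord0 addr0 expn0 expr1 subrK.
rewrite big_ord_recr /= expnS mulnC exprM -smooth_step_diff {1}IH.
by rewrite !addrA subrK.
Qed.

End PartitionOfUnity.

Section PartitionEvaluation.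
Variable A : comNzRingType.
Implicit Types (p : {poly A}) (z : A).

Lemma horner_natr n z : (n%:R : {poly A}).[z] = n%:R.
Proof. by rewrite -polyC_natr hornerC. Qed.

Let hE := (horner_exp, horner_natr, horner_natr 1, hornerN, hornerD, hornerM).

Lemma horner_dyadic_quotient p z :
  (dyadic_quotient p).[z] = dyadic_quotient p.[z].
Proof. by rewrite /dyadic_quotient !hE. Qed.

Lemma horner_smooth_rest p z : (smooth_rest p).[z] = smooth_rest p.[z].
Proof. by rewrite /smooth_rest !hE. Qed.

End PartitionEvaluation.

(** * Decoupling by random signs *)

Section Decoupling.
Variables (R : realType) (X : completeNormedModType R[i]).

(** For [i != j], flipping the sign of index [i] turns the sum into its opposite. *)
Lemma sum_sign_ortho n (i j : 'I_n) :
  \sum_(e : {ffun 'I_n -> bool}) (-1) ^+ e i * (-1) ^+ e j =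
  (i == j)%:R * 2 ^+ n :> R[i].
Proof.
have [->|ij] := eqVneq i j.
  rewrite mul1r; under eq_bigr do rewrite -signr_addb addbb expr0.
  by rewrite sumr_const card_ffun card_bool card_ord natrX.
rewrite mul0r; set s := LHS.
pose h (e : {ffun 'I_n -> bool}) := [ffun l => e l (+) (l == i)].
have hK : involutive h.
  by move=> e; apply/ffunP => l; rewrite !ffunE -addbA addbb addbF.
have : s = - s.
  rewrite {1}/s (reindex h) /=; last by exists h => e _; apply: hK.
  rewrite /s -sumrN; apply: eq_bigr => e _.
  by rewrite !ffunE eqxx eq_sym (negbTE ij) addbF addbT signrN mulNr.
by move/eqP; rewrite -addr_eq0 -mulr2n mulrn_eq0 => /eqP.
Qed.

(* [sum_j A_j y_j] is the average of [(sum_j e_j A_j) (sum_i e_i y_i)] over the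
   signs [e]. *)
Lemma Rademacher_decoupling n (A : 'I_n -> X -> X) (K : R) (y : 'I_n -> X) :
  (forall j, linear (A j)) ->
  (forall (e : 'I_n -> bool) x,
     rnorm (\sum_j (-1) ^+ e j *: A j x) <= K * rnorm x) ->
  rnorm (\sum_j A j (y j)) <= K * Rademacher_mean y.
Proof.
move=> Alin AK.
have e1 : 2 ^+ n *: (\sum_j A j (y j)) =
    \sum_(e : {ffun 'I_n -> bool}) \sum_j (-1) ^+ e j *:
       A j (\sum_i (-1) ^+ e i *: y i).
  transitivity (\sum_j \sum_i \sum_(e : {ffun 'I_n -> bool})
      ((-1) ^+ e j * (-1) ^+ e i) *: A j (y i)).
    rewrite scaler_sumr; apply: eq_bigr => j _.
    rewrite (bigD1 j) //= -scaler_suml sum_sign_ortho eqxx mul1r.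
    rewrite big1 ?addr0 // => i ij.
    by rewrite -scaler_suml sum_sign_ortho eq_sym (negbTE ij) mul0r scale0r.
  rewrite [RHS]exchange_big; apply: eq_bigr => j _ /=.
  rewrite exchange_big; apply: eq_bigr => e _ /=.
  rewrite (linear_map_sum _ _ _ (Alin j)) scaler_sumr; apply: eq_bigr => i _.
  by rewrite (linear_mapZ _ _ (Alin j)) scalerA.
have p2 : 0 < 2 ^+ n :> R := pow2_gt0 R n.
rewrite /Rademacher_mean mulrA ler_pdivlMr // mulrC.
have -> : 2 ^+ n * rnorm (\sum_j A j (y j)) = rnorm ((2 ^+ n : R[i]) *: \sum_j A j (y j)).
  by rewrite rnormZ rnormX rnorm_nat.
rewrite e1 mulr_sumr.
by apply: le_trans (ler_rnorm_sum _ _ _) _; apply: ler_sum => e _; apply: AK.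
Qed.

End Decoupling.

(** * Bounds on the closed disc for the partition of unity *)

Section PolynomialEstimates.
Variables (R : realType).
Implicit Types (z w : R[i]).

Lemma rnorm_one_minus_exp w n : rnorm w <= 1 -> rnorm (1 - w ^+ n) <= n%:R * rnorm (1 - w).
Proof.
move=> w1; elim: n => [|n IH]; first by rewrite expr0 subrr rnorm0 mul0r.
have -> : 1 - w ^+ n.+1 = (1 - w) + w * (1 - w ^+ n) by rewrite exprS; ring.
apply: le_trans (ler_rnormD _ _) _; rewrite -[n.+1%:R]natr1 mulrDl mul1r addrC.
rewrite lerD2r rnormM; apply: le_trans IH.
by rewrite ler_piMl ?rnorm_ge0.
Qed.

Lemma rnorm_natM n z (c : R) : rnorm z <= c -> rnorm (n%:R * z) <= n%:R * c.
Proof. by move=> h; rewrite rnormM rnorm_nat ler_wpM2l. Qed.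

Lemma rnormX_le1 z n : rnorm z <= 1 -> rnorm (z ^+ n) <= 1.
Proof. by move=> h; rewrite rnormX exprn_ile1 ?rnorm_ge0. Qed.

(** [70] is the sum of the coefficients; the factor [1 - z ^ n] costs [n |1 - z|], which is the form
    required on the contour. *)
Lemma rnorm_dyadic_quotient z n : rnorm z <= 1 ->
  rnorm (dyadic_quotient (z ^+ n)) <= 70 * (rnorm z ^+ n * (n%:R * rnorm (1 - z))).
Proof.
move=> z1; rewrite /dyadic_quotient !rnormM mulrC; apply: ler_pM.
- exact: rnorm_ge0.
- by rewrite mulr_ge0 ?rnorm_ge0.
- set w := z ^+ n; have w1 : rnorm w <= 1 by apply: rnormX_le1.
  have -> : 70 = 10 + 15 * 1 + 21 * 1 + 18 * 1 + 6 * 1 :> R by ring.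
  do 4 (apply: le_trans (ler_rnormD _ _) _; apply: lerD;
    last by apply: rnorm_natM; rewrite ?rnormX_le1).
  by rewrite rnorm_nat.
- rewrite rnormX ler_wpM2l ?exprn_ge0 ?rnorm_ge0 //.
  exact: rnorm_one_minus_exp.
Qed.

Lemma rnorm_smooth_rest z : rnorm z <= 1 -> rnorm (smooth_rest z) <= 40.
Proof.
move=> z1; rewrite /smooth_rest rnormM rnormX.
have h1 : rnorm (1 - z) <= 2.
  by apply: le_trans (ler_rnormB _ _) _; rewrite rnorm1; lra.
have -> : 40 = 2 ^+ 2 * (1 + 3 * 1 + 6 * 1) :> R by ring.
apply: ler_pM; rewrite ?exprn_ge0 ?rnorm_ge0 //.
  by rewrite lerXn2r ?nnegrE ?rnorm_ge0.
do 2 (apply: le_trans (ler_rnormD _ _) _; apply: lerD;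
  last by apply: rnorm_natM; rewrite ?rnormX_le1).
by rewrite rnorm1.
Qed.

End PolynomialEstimates.

(** * Estimates of the pieces of [P(T)] and their sum *)

Section Assembly.
Variables (R : realType) (X : completeNormedModType R[i]).
Variables (T : X -> X) (T_lin : linear T) (k C K : R).
Hypotheses (k_gt0 : 0 < k) (k_le : k <= 16^-1) (C0 : 0 <= C) (K0 : 0 <= K).
Hypothesis curve_calculus : forall (m : nat) (Q : 'I_m -> {poly R[i]})
    (n : 'I_m -> nat) (M : R), 0 < M ->
  (forall i t, `|t| <= pi -> rnorm (Q i).[curve k t] <=
     M * (n i).+1%:R * `|t| * (1 - k * `|t|) ^+ n i) ->
  forall x : 'I_m -> X,
  Rademacher_mean (fun i => poly_op (Q i) T (x i)) <= C * M * Rademacher_mean x.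
Hypothesis uncond : forall n (a : nat -> R[i]) x, (forall j, rnorm (a j) <= 1) ->
  rnorm (\sum_(j < n) a j *: (iter j.+1 T x - iter j T x)) <= K * rnorm x.

Lemma curve_calculus1 (Q : {poly R[i]}) (n : nat) (M : R) x : 0 < M ->
  (forall t, `|t| <= pi -> rnorm Q.[curve k t] <=
     M * n.+1%:R * `|t| * (1 - k * `|t|) ^+ n) ->
  rnorm (poly_op Q T x) <= C * M * rnorm x.
Proof.
move=> M0 h; have := @curve_calculus 1 (fun=> Q) (fun=> n) M M0 (fun=> h) (fun=> x).
by rewrite !Rademacher1.
Qed.

Lemma telescope_iter m n x : (m <= n)%N ->
  \sum_(m <= j < n) (iter j.+1 T x - iter j T x) = iter n T x - iter m T x.
Proof. by move=> mn; rewrite (telescope_sumr (fun j => iter j T x)). Qed.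

(** The unconditional condition with all coefficients [1] telescopes to [T ^ n - 1]. *)
Lemma power_bounded n x : rnorm (iter n T x) <= (1 + K) * rnorm x.
Proof.
have := uncond n x (fun j : nat => _ : rnorm ((fun=> 1) j : R[i]) <= 1).
have -> : \sum_(j < n) (fun=> 1 : R[i]) (j : nat) *: (iter j.+1 T x - iter j T x) =
    iter n T x - x.
  under eq_bigr do rewrite scale1r.
  by rewrite -(big_mkord xpredT (fun j => iter j.+1 T x - iter j T x)) telescope_iter.
rewrite rnorm1 lexx => /(_ (fun=> isT)) h.
have := ler_rnorm_dist (iter n T x) x; lra.
Qed.

(** [z ^ n (1 - z)] lacks the factor [n + 1] of the contour condition, so [M = 2 / (n + 1)] is
    admissible. *)
Lemma difference_decay n x :
  rnorm (poly_op ('X^n * (1 - 'X)) T x) <= C * (2 / n.+1%:R) * rnorm x.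
Proof.
apply: (@curve_calculus1 _ n) => [|t ht]; first by rewrite divr_gt0.
rewrite !hornerE rnormM rnormX (rnorm_curve k_gt0 k_le ht) mulrC.
rewrite divfK ?pnatr_eq0 //; apply: ler_wpM2r.
  by apply: exprn_ge0; have := radius_ge k_gt0 k_le ht; lra.
by rewrite rnormBC rnorm_curve_sub1.
Qed.

Definition dyadic_diff (j : nat) : {poly R[i]} := 'X^(2 ^ j.+1) - 'X^(2 ^ j).

(** A dyadic difference is a block of consecutive differences: [a] is the constant sign [e j] on the
    indices from [2 ^ j] to [2 ^ j.+1 - 1], and [0] at index [0]. *)
Lemma dyadic_signs N (e : nat -> bool) : exists a : nat -> R[i],
  (forall j, rnorm (a j) <= 1) /\
  forall x, \sum_(j < N) (-1) ^+ e j *: poly_op (dyadic_diff j) T x =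
    \sum_(j < 2 ^ N) a j *: (iter j.+1 T x - iter j T x).
Proof.
elim: N => [|N [a [a1 ha]]].
  exists (fun=> 0); split; first by move=> j; rewrite rnorm0.
  by move=> x; rewrite big_ord0 big1 // => i _; rewrite scale0r.
exists (fun j => if (j < 2 ^ N)%N then a j else (-1) ^+ e N); split.
  by move=> j; case: ifP => // _; rewrite rnorm_sign.
have le2 : (2 ^ N <= 2 ^ N.+1)%N by rewrite leq_exp2l.
move=> x; rewrite big_ord_recr ha -(big_mkord xpredT (fun j =>
  (if (j < 2 ^ N)%N then a j else (-1) ^+ e N) *: (iter j.+1 T x - iter j T x))).
rewrite (big_cat_nat _ le2) //=; congr (_ + _).
  rewrite big_mkord; apply: eq_bigr => j _; by rewrite ltn_ord.
rewrite /dyadic_diff poly_opB // !poly_opXn // -telescope_iter // scaler_sumr.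
by apply: eq_big_nat => j /andP[h _]; rewrite ltnNge h.
Qed.

Lemma dyadic_sign_bound N (e : 'I_N -> bool) x :
  rnorm (\sum_j (-1) ^+ e j *: poly_op (dyadic_diff j) T x) <= K * rnorm x.
Proof.
pose e' (j : nat) := if insub j is Some i then e i else false.
have [a [a1 ha]] := dyadic_signs N e'.
have -> : \sum_j (-1) ^+ e j *: poly_op (dyadic_diff j) T x =
    \sum_(j < N) (-1) ^+ e' j *: poly_op (dyadic_diff j) T x.
  by apply: eq_bigr => j _; rewrite /e' valK.
by rewrite ha; apply: uncond.
Qed.

Variables (P : {poly R[i]}) (M : R).
Hypothesis M_gt0 : 0 < M.
Hypothesis P_le : forall t, 0 < `|t| <= pi -> rnorm P.[curve k t] <= M.

(** One factor [K] comes from decoupling and one from the signed sums of the inner differences;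
    between them the contour calculus applies with constant [140 M], uniformly in [j]. *)
Lemma dyadic_part N x :
  rnorm (\sum_(j < N) poly_op (dyadic_diff j) T
    (poly_op (P * dyadic_quotient 'X^(2 ^ j)) T (poly_op (dyadic_diff j) T x)))
  <= C * 140 * K ^+ 2 * M * rnorm x.
Proof.
apply: le_trans (@Rademacher_decoupling _ _ _
  (fun j : 'I_N => poly_op (dyadic_diff j) T) K _ _ _) _.
- by move=> j; apply: linear_poly_op.
- by move=> e y; apply: dyadic_sign_bound.
have -> : C * 140 * K ^+ 2 * M * rnorm x = K * (C * (140 * M) * (K * rnorm x)).
  by ring.
apply: ler_wpM2l => //.
have M140 : 0 < 140 * M by rewrite mulr_gt0.
apply: le_trans (@curve_calculus N (fun j => P * dyadic_quotient 'X^(2 ^ j))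
  (fun j => (2 ^ j)%N) (140 * M) M140 _ _) _; last first.
  apply: ler_wpM2l; first by rewrite mulr_ge0 // ltW.
  by apply: Rademacher_mean_le => e; apply: dyadic_sign_bound.
move=> i t ht; set n := (2 ^ i)%N.
have -> : (P * dyadic_quotient 'X^n).[curve k t] =
    P.[curve k t] * dyadic_quotient (curve k t ^+ n).
  by rewrite hornerM horner_dyadic_quotient hornerXn.
have c1 := rnorm_curve_le1 k_gt0 k_le ht.
have hq := rnorm_dyadic_quotient n c1.
have v0 : 0 <= 1 - k * `|t| by have := radius_ge k_gt0 k_le ht; lra.
(* [P_le] says nothing at the corner, but the quotient vanishes there. *)
have [t0|t0] := eqVneq t 0.
  move: hq; rewrite t0 curve0 subrr rnorm0 !mulr0 normr0 !mulr0 mul0r => hq.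
  rewrite rnormM (_ : rnorm (dyadic_quotient _) = 0) ?mulr0 //.
  by apply/eqP; rewrite eq_le hq rnorm_ge0.
have tt : 0 < `|t| <= pi by rewrite normr_gt0 t0.
rewrite rnormM; apply: le_trans (ler_pM _ _ (P_le tt) hq) _;
  rewrite ?rnorm_ge0 // (rnorm_curve k_gt0 k_le ht).
have h2 := rnorm_curve_sub1 k_gt0 k_le t; rewrite rnormBC in h2.
apply: le_trans (_ : M * (70 * ((1 - k * `|t|) ^+ n * (n.+1%:R * (2 * `|t|)))) <= _).
  apply: ler_wpM2l; first exact: ltW.
  rewrite ler_pM2l //; apply: ler_wpM2l; first exact: exprn_ge0.
  by apply: ler_pM; rewrite ?rnorm_ge0 // ler_nat.
by rewrite le_eqVlt; apply/orP; left; apply/eqP; ring.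
Qed.

Lemma rest_part x :
  rnorm (poly_op (P * ((1 - 'X) * smooth_rest 'X)) T x) <= C * 80 * M * rnorm x.
Proof.
have M80 : 0 < 80 * M by rewrite mulr_gt0.
rewrite -[C * 80 * M]mulrA.
apply: (@curve_calculus1 _ 0) => // t ht.
have -> : (P * ((1 - 'X) * smooth_rest 'X)).[curve k t] =
    P.[curve k t] * ((1 - curve k t) * smooth_rest (curve k t)).
  rewrite hornerM [(_ * smooth_rest _).[_]]hornerM.
  by rewrite horner_smooth_rest !hornerE.
rewrite expr0 !mulr1.
have [t0|t0] := eqVneq t 0.
  by rewrite t0 curve0 subrr mul0r mulr0 rnorm0 normr0 mulr0.
have tt : 0 < `|t| <= pi by rewrite normr_gt0 t0.
have c1 := rnorm_curve_le1 k_gt0 k_le ht.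
have h2 := rnorm_curve_sub1 k_gt0 k_le t; rewrite rnormBC in h2.
rewrite rnormM [rnorm (_ * smooth_rest _)]rnormM.
apply: le_trans (_ : M * (2 * `|t| * 40) <= _).
  apply: ler_pM; rewrite ?mulr_ge0 ?rnorm_ge0 //; first exact: P_le.
  by apply: ler_pM; rewrite ?rnorm_ge0 //; exact: rnorm_smooth_rest.
by rewrite le_eqVlt; apply/orP; left; apply/eqP; ring.
Qed.

(** The corner is a limit of curve points where [P_le] applies; [P - P(1) = Q (z - 1)] makes the
    error explicit. *)
Lemma value_at_1 : rnorm P.[1] <= M.
Proof.
have : root (P - P.[1]%:P) 1 by rewrite /root !hornerE subrr.
move=> /factor_theorem [Q PQ].
pose L := \sum_(a < size Q) rnorm Q`_a.
apply: (@ler_addr_invn _ _ _ (2 * L)) => n; pose t : R := n.+1%:R^-1.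
have t0 : 0 < t by rewrite invr_gt0 ltr0n.
have tn : `|t| = t by rewrite gtr0_norm.
have ht : `|t| <= pi.
  rewrite tn; apply: le_trans (_ : 1 <= _); first by rewrite invf_le1 ?ler1n ?ltr0n.
  by have := @pi_ge2 R; lra.
have tt : 0 < `|t| <= pi by rewrite {1}tn t0.
have e : P.[1] = P.[curve k t] - Q.[curve k t] * (curve k t - 1).
  have := congr1 (horner^~ (curve k t)) PQ; rewrite !hornerE => <-.
  by rewrite opprB addrC subrK.
rewrite e; apply: le_trans (ler_rnormB _ _) _; apply: lerD; first exact: P_le.
rewrite rnormM -mulrA mulrCA; apply: ler_pM; rewrite ?rnorm_ge0 //; last first.
  by rewrite -/t -{2}tn rnorm_curve_sub1.
rewrite horner_coef; apply: le_trans (ler_rnorm_sum _ _ _) _.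
apply: ler_sum => a _; rewrite rnormM ler_piMr ?rnorm_ge0 //.
by apply: rnormX_le1; apply: rnorm_curve_le1.
Qed.

Lemma poly_op_natM n (Q : {poly R[i]}) x :
  rnorm (poly_op (n%:R * Q) T x) = n%:R * rnorm (poly_op Q T x).
Proof. by rewrite -polyC_natr mul_polyC poly_opZ // rnormZ rnorm_nat. Qed.

Lemma power_combination a b c x :
  rnorm (poly_op (10 * 'X^a - 15 * 'X^b + 6 * 'X^c) T x) <= 31 * (1 + K) * rnorm x.
Proof.
rewrite poly_opD // poly_opB //.
have -> : 31 * (1 + K) * rnorm x = 10 * ((1 + K) * rnorm x) +
  15 * ((1 + K) * rnorm x) + 6 * ((1 + K) * rnorm x) by ring.
apply: le_trans (ler_rnormD _ _) _; apply: lerD.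
  apply: le_trans (ler_rnormB _ _) _; apply: lerD;
  by rewrite poly_op_natM poly_opXn // ler_wpM2l // power_bounded.
by rewrite poly_op_natM poly_opXn // ler_wpM2l // power_bounded.
Qed.

(** In [P = P(1) - Q (1 - X)] the constant is handled by power boundedness. The other term contains
    [T ^ n (1 - T)] with [n = 2 ^ N], which tends to [0]; its constant [c] depends on [P] and
    [x]. *)
Lemma tail_part x : exists c, 0 <= c /\ forall N,
  rnorm (poly_op (P * smooth_step 'X^(2 ^ N)) T x) <=
  31 * (1 + K) * M * rnorm x + c / N.+1%:R.
Proof.
have : root (P - P.[1]%:P) 1 by rewrite /root !hornerE subrr.
move=> /factor_theorem [Q PQ].
have PE : P = P.[1]%:P - Q * (1 - 'X).
  by rewrite -[LHS](subrK P.[1]%:P) PQ polyC1; ring.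
pose c := C * 2 * (31 * (1 + K) * rnorm (poly_op Q T x)).
have c0 : 0 <= c by rewrite !mulr_ge0 ?addr_ge0 ?rnorm_ge0.
exists c; split => // N; set n := (2 ^ N)%N.
pose g : {poly R[i]} := 10 * 'X^(n * 2) - 15 * 'X^(n * 3) + 6 * 'X^(n * 4).
have gE : smooth_step 'X^n = 'X^n * g.
  by rewrite /smooth_step /g !exprM; ring.
have gE' : smooth_step 'X^n =
    10 * 'X^(n * 3) - 15 * 'X^(n * 4) + 6 * 'X^(n * 5) :> {poly R[i]}.
  by rewrite /smooth_step !exprM; ring.
have -> : P * smooth_step 'X^n =
    P.[1] *: smooth_step 'X^n - ('X^n * (1 - 'X)) * (g * Q).
  by rewrite {1}PE mulrBl -mul_polyC [in RHS]gE; rewrite gE; ring.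
rewrite poly_opB // poly_opZ // [poly_op (_ * (g * Q)) _ _]poly_opM //.
rewrite [poly_op (g * Q) _ _]poly_opM //.
apply: le_trans (ler_rnormB _ _) _; apply: lerD.
  rewrite rnormZ.
  have -> : 31 * (1 + K) * M * rnorm x = M * (31 * (1 + K) * rnorm x) by ring.
  apply: ler_pM; rewrite ?rnorm_ge0 ?value_at_1 //.
  by rewrite gE' power_combination.
apply: le_trans (difference_decay _ _) _.
have -> : c / N.+1%:R =
    C * (2 / N.+1%:R) * (31 * (1 + K) * rnorm (poly_op Q T x)).
  by rewrite /c; ring.
apply: ler_pM; rewrite ?mulr_ge0 ?rnorm_ge0 ?divr_ge0 //; last first.
  exact: power_combination.
rewrite ler_wpM2l // ler_pM2l // lef_pV2 ?posrE ?ltr0n // ler_nat ltnS.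
by apply: ltnW; apply: ltn_expl.
Qed.

(** The partition of unity is multiplied by [P] and applied to [T]; [N] tends to infinity to remove
    the tail error. *)
Lemma curve_bound x :
  rnorm (poly_op P T x) <= (C * 80 + C * 140 * K ^+ 2 + 31 * (1 + K)) * M * rnorm x.
Proof.
have [c [c0 hc]] := tail_part x.
apply: (@ler_addr_invn _ _ _ c) => N.
have PE : P = P * ((1 - 'X) * smooth_rest 'X)
    + \sum_(j < N) dyadic_diff j * (P * dyadic_quotient 'X^(2 ^ j) * dyadic_diff j)
    + P * smooth_step 'X^(2 ^ N).
  have := congr1 (fun q => P * q) (partition_of_unity 'X N).
  rewrite mulr1 !mulrDr mulr_sumr => {1}->.
  by congr (_ + _ + _); apply: eq_bigr => j _; rewrite /dyadic_diff; ring.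
rewrite {1}PE !poly_opD // poly_op_sum //.
have -> : (C * 80 + C * 140 * K ^+ 2 + 31 * (1 + K)) * M * rnorm x + c / N.+1%:R =
  C * 80 * M * rnorm x + C * 140 * K ^+ 2 * M * rnorm x +
  (31 * (1 + K) * M * rnorm x + c / N.+1%:R) by ring.
apply: le_trans (ler_rnormD _ _) _; apply: lerD => //.
apply: le_trans (ler_rnormD _ _) _; apply: lerD; first exact: rest_part.
under eq_bigr do rewrite poly_opM // [poly_op (P * _ * _) _ _]poly_opM //.
exact: dyadic_part.
Qed.

End Assembly.


Theorem theorem4p2 (R : realType) (X : completeNormedModType R[i])
    (T : X -> X) (T_bounded : bounded_operator T)
    (T_R_Ritt : R_Ritt T) (T_uncond : unconditional_Ritt T) :
  exists gamma : R,
    (0 < gamma < pi / 2) /\ bounded_Hinfty_calculus gamma T.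
Proof.
have [T_lin [tau [tau0 T_bound]]] := (bounded_operatorP T).1 T_bounded.
have [[specT _] [C1 [C10 hC1]]] := T_R_Ritt.
have [K [K0 hK]] := T_uncond.
(* Enlarged to ensure [C0 >= 1], as the resolvent estimates require. *)
pose C0 := C1 + 1.
have C01 : 1 <= C0 by rewrite lerDr.
have C0_gt0 : 0 < C0 by apply: lt_le_trans C01.
have hC0 n (S : 'I_n -> X -> X) (x : 'I_n -> X) : (forall j, Ritt_set T (S j)) ->
    Rademacher_mean (fun j => S j (x j)) <= C0 * Rademacher_mean x.
  move=> /hC1 => /(_ x) h; apply: le_trans h _.
  by rewrite ler_wpM2r ?Rademacher_ge0 // lerDl.
pose k : R := (16 * C0)^-1 / 8.
have k_gt0 : 0 < k by rewrite divr_gt0 // invr_gt0 mulr_gt0.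
have k_le : k <= 16^-1.
  rewrite /k invfM -mulrA -[leRHS]mulr1; apply: ler_wpM2l => //.
  rewrite ler_pdivrMr // mul1r; apply: le_trans (_ : 1 <= _); last by rewrite ler1n.
  by rewrite invf_le1.
have calculus := contour_calculus T_lin T_bound tau0 specT C01 hC0.
pose C := 1536 * C0 / k.
have C_ge0 : 0 <= C.
  apply: divr_ge0; last exact: ltW.
  by apply: mulr_ge0; [exact: ler0n | exact: ltW].
have curve_calculus m (Q : 'I_m -> {poly R[i]}) (n : 'I_m -> nat) (M : R) :
    0 < M ->
    (forall i t, `|t| <= pi -> rnorm (Q i).[curve k t] <=
       M * (n i).+1%:R * `|t| * (1 - k * `|t|) ^+ n i) ->
    forall x : 'I_m -> X,
    Rademacher_mean (fun i => poly_op (Q i) T (x i)) <= C * M * Rademacher_mean x.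
  move=> M0 hQ x; have := calculus m Q n M M0 hQ x.
  by rewrite [_ * M / _]mulrAC.
clearbody C; clear calculus.
have uncond n (a : nat -> R[i]) x : (forall j, rnorm (a j) <= 1) ->
    rnorm (\sum_(j < n) a j *: (iter j.+1 T x - iter j T x)) <= K * rnorm x.
  move=> a1; pose S y := \sum_(j < n) a j *: (iter j.+1 T y - iter j T y).
  have S_lin : linear S.
    move=> b y z; rewrite /S scaler_sumr -big_split; apply: eq_bigr => j _.
    rewrite !(linear_iter _ T_lin) opprD addrACA -scalerBr scalerDr.
    by rewrite !scalerA mulrC.
  apply: (opnorm_bound (S := S) x S_lin).
  apply: le_trans (hK n (fun j => a j)) _; rewrite lee_fin ler_piMr //.
  by apply: bigmax_le.
have k1 : k <= 1 by apply: le_trans k_le _; rewrite invf_le1 // ler1n.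
have k2 : -1 <= k / 2 < 1 by apply/andP; split; move: k_gt0 k1; lra.
have kcos : cos (acos (k / 2)) = k / 2.
  by apply: acosK; rewrite in_itv /=; case/andP: k2 => -> /ltW.
(* This is the angle with [cos gamma = k / 2] demanded by [curve_in_Stolz]; it is below [pi / 2]
   because [k > 0]. *)
exists (acos (k / 2)).
have g_gt0 : 0 < acos (k / 2) by exact: acos_gt0.
have g_lepi : acos (k / 2) <= pi.
  by apply: acos_lepi; case/andP: k2 => -> /ltW.
have g_lt : acos (k / 2) < pi / 2.
  rewrite -ltr_cos ?in_itv /= ?(ltW g_gt0) //; last first.
    by rewrite divr_ge0 ?pi_ge0 //= ler_pdivrMr // ler_peMr ?pi_ge0 // ler1n.
  by rewrite cos_pihalf kcos divr_gt0.
split; first by rewrite g_gt0.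
have sin_g : 0 <= sin (acos (k / 2)) by apply: sin_ge0_pi; rewrite ltW.
pose D := C * 80 + C * 140 * K ^+ 2 + 31 * (1 + K).
have D_gt0 : 0 < D.
  apply: ltr_wpDl; first by rewrite addr_ge0 ?mulr_ge0 ?exprn_ge0.
  by rewrite mulr_gt0 // ltr_pwDl.
exists D; split; first exact: ltW.
move=> P; set s := ereal_sup _.
have in_Stolz t : 0 < `|t| <= pi -> Stolz_domain (acos (k / 2)) (curve k t).
  exact: curve_in_Stolz.
have sup_ge t : 0 < `|t| <= pi -> ((rnorm P.[curve k t])%:E <= s)%E.
  by move=> /in_Stolz ht; apply: ereal_sup_ubound; exists (curve k t).
have pi_in : 0 < `|pi : R| <= pi by rewrite gtr0_norm ?pi_gt0 ?lexx.
have s_ge0 : (0 <= s)%E by apply: le_trans (sup_ge _ pi_in); rewrite lee_fin rnorm_ge0.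
(* An infinite supremum makes the bound trivial, thanks to [D > 0]. *)
have [->|s_fin] := eqVneq s +oo%E.
  by rewrite gt0_muley ?lte_fin // leey.
have sE : s = (fine s)%:E.
  by rewrite fineK // ge0_fin_numE // lt_neqAle s_fin leey.
have M0 : 0 <= fine s by apply: fine_ge0.
rewrite sE -EFinM; apply: opnorm_le; first by rewrite mulr_ge0 // ltW.
move=> x; apply: (@ler_addr_invn _ _ _ (D * rnorm x)) => n.
have e_gt0 : 0 < n.+1%:R^-1 :> R by rewrite invr_gt0 ltr0n.
(* [curve_bound] asks for a positive bound while the supremum may vanish; the excess tends to
   [0]. *)
have M_gt0 : 0 < fine s + n.+1%:R^-1 by rewrite ltr_wpDl.
have := curve_bound T_lin k_gt0 k_le C_ge0 K0 curve_calculus uncond M_gt0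
  (P := P) _ x.
rewrite -/D => h; apply: le_trans (h _) _.
  move=> t ht; have := sup_ge t ht; rewrite sE lee_fin => /le_trans; apply.
  by rewrite lerDl ltW.
by rewrite le_eqVlt; apply/orP; left; apply/eqP; ring.
Qed.
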